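(* Let $\boldsymbol{K}=\mathbb{Q}(i)$ and, for $k\in\mathbb{N}$, let $\psi_{4k}=\frac14\sum_{\boldsymbol{m}\in\mathcal{E}}\theta_{\boldsymbol{m}}^{4k}$, where $\theta_{\boldsymbol{m}}$ ($\boldsymbol{m}\in\mathcal{E}$) are the ten degree 2 Hermitian theta constants with even characteristic. Then the following congruences hold: (1) $\varTheta(\psi_8)\equiv0\pmod7$; (2) $\varTheta(\psi_{12})\equiv0\pmod{11}$.
   Context: Let $\boldsymbol{K}=\mathbb{Q}(i)$ and $\mathbb{H}_2=\{Z\in \mathrm{Mat}_2(\mathbb{C}) : \frac{1}{2i}(Z-{}^t\overline{Z})>0\}$. Write $A\{B\}={}^t\overline{B}AB$. For $\boldsymbol{m}=\begin{pmatrix}\boldsymbol{a}\\\boldsymbol{b}\end{pmatrix}$ with column vectors $\boldsymbol{a},\boldsymbol{b}\in\mathbb{Z}[i]^{2}$, the Hermitian theta constant is $$\theta_{\boldsymbol{m}}(Z)=\sum_{\boldsymbol{g}\in\mathbb{Z}[i]^{2}}\exp\Bigl[\pi i\Bigl(Z\Bigl\{\boldsymbol{g}+\tfrac{1+i}{2}\boldsymbol{a}\Bigr\}+2\,\mathrm{Re}\,\tfrac{1+i}{2}\,{}^t\boldsymbol{b}\,\boldsymbol{g}\Bigr)\Bigr],\qquad Z\in\mathbb{H}_2 .$$ The set $\mathcal{E}$ of even characteristics of degree 2 mod 2 consists of the ten vectors ${}^t(a_1,a_2,b_1,b_2)$ with $(a_1,a_2,b_1,b_2)$ equal to $(0,0,0,0)$,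 $(0,0,0,1)$, $(0,0,1,0)$, $(0,0,1,1)$, $(0,1,0,0)$, $(0,1,1,0)$, $(1,0,0,0)$, $(1,0,0,1)$, $(1,1,0,0)$, $(1,1,1,1)$. By a theorem of Freitag, $\psi_{4k}$ is a symmetric Hermitian modular form of weight $4k$ for the Hermitian modular group $\Gamma^2(\mathbb{Z}[i])=\{M\in\mathrm{Mat}_4(\mathbb{Z}[i]):{}^t\overline{M}J_2M=J_2\}$, $J_2=\begin{pmatrix}0&-1_2\\1_2&0\end{pmatrix}$, with integral Fourier coefficients in the expansion $F(Z)=\sum_{0\le H\in\Lambda_2(\boldsymbol{K})}a(F;H)\boldsymbol{q}^H$, $\boldsymbol{q}^H=\exp(2\pi i\,\mathrm{tr}(HZ))$, where $\Lambda_2(\boldsymbol{K})$ is the set of Hermitian $2\times2$ matrices $H=(h_{jl})$ over $\boldsymbol{K}$ with $h_{jj}\in\mathbb{Z}$ and $2h_{jl}\in\mathbb{Z}[i]$. The theta operator is $\varTheta:\ \sum a(F;H)\boldsymbol{q}^H\mapsto\sum a(F;H)\det(H)\boldsymbol{q}^H$. A congruence mod $p$ between such series means congruence in $\mathbb{Z}_{(p)}$ (the $p$-integral rationals) of all coefficients. *)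

(* Defs.v *)
From mathcomp Require Import all_boot all_order all_algebra finmap.
From mathcomp Require Import complex.
From mathcomp Require Import boolp classical_sets reals topology normedtype sequences.
From mathcomp Require Import exp trigo.
From mathcomp Require Import summability.

Set Implicit Arguments.
Unset Strict Implicit.
Unset Printing Implicit Defensive.

Import Order.TTheory GRing.Theory Num.Theory.
Import numFieldNormedType.Exports.

Local Open Scope classical_set_scope.
Local Open Scope ring_scope.
Local Open Scope complex_scope.

Notation gauss_int := (int[i]).

Notation QI := (rat[i]).

(* The field [R[i]] with the topology given by its norm. *)
Notation Ctop R := (R[i]^o).

(* ['i] in [ring_scope] is an unspecified square root of -1; ['i%C] is
   [0 +i* 1]. *)

Section Hermitian.
Variable R : realType.

Definition gauss_to_C (x : gauss_int) : R[i] :=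
  (complex.Re x)%:~R +i* (complex.Im x)%:~R.

Definition QI_to_C (x : QI) : R[i] := ratr (complex.Re x) +i* ratr (complex.Im x).

Definition cexp (z : R[i]) : R[i] :=
  (expR (complex.Re z))%:C * (cos (complex.Im z) +i* sin (complex.Im z)).

Definition conjtr (S : pzRingType) (m n : nat) (A : 'M[S[i]]_(m, n)) :
  'M[S[i]]_(n, m) := map_mx conjc A^T.

Definition hermitian_mx (S : pzRingType) (n : nat) (A : 'M[S[i]]_n) : Prop :=
  conjtr A = A.

(* The Hermitian substitution written [A{B}] in the literature. *)
Definition herm_act (m n : nat) (A : 'M[R[i]]_m) (B : 'M[R[i]]_(m, n)) :
  'M[R[i]]_n := conjtr B *m A *m B.

(* In [R[i]], [0 < z] and [0 <= z] entail that [z] is real. *)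
Definition posdef_mx (n : nat) (A : 'M[R[i]]_n) : Prop :=
  hermitian_mx A /\ forall v : 'cV[R[i]]_n, v != 0 -> 0 < herm_act A v 0 0.

Definition possemidef_mx (n : nat) (A : 'M[R[i]]_n) : Prop :=
  hermitian_mx A /\ forall v : 'cV[R[i]]_n, 0 <= herm_act A v 0 0.

Definition upper_half : set 'M[R[i]]_2 :=
  [set Z | posdef_mx ((2 * 'i%C)^-1 *: (Z - conjtr Z))].

Definition omega : R[i] := (1 + 'i%C) / 2.

Definition theta_term (a b : 'cV[gauss_int]_2) (Z : 'M[R[i]]_2)
    (g : 'cV[gauss_int]_2) : R[i] :=
  let a' := map_mx gauss_to_C a in
  let b' := map_mx gauss_to_C b in
  let g' := map_mx gauss_to_C g in
  cexp (pi%:C * 'i%C * (herm_act Z (g' + omega *: a') 0 0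
                         + 2 * (complex.Re (omega * (b'^T *m g') 0 0))%:C)).

(* [sum] is the limit of the finite partial sums along the directed set of
   finite subsets of the index type, that is, the unconditional sum. *)
Definition theta_const (m : 'cV[gauss_int]_2 * 'cV[gauss_int]_2)
    (Z : 'M[R[i]]_2) : R[i] :=
  sum (theta_term m.1 m.2 Z : 'cV[gauss_int]_2 -> Ctop R).

Definition characteristic (a1 a2 b1 b2 : int) :
    'cV[gauss_int]_2 * 'cV[gauss_int]_2 :=
  (\col_j (tnth [tuple a1; a2] j +i* 0), \col_j (tnth [tuple b1; b2] j +i* 0)).

Definition even_characteristics : seq ('cV[gauss_int]_2 * 'cV[gauss_int]_2) :=
  [:: characteristic 0 0 0 0; characteristic 0 0 0 1;
      characteristic 0 0 1 0; characteristic 0 0 1 1;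
      characteristic 0 1 0 0; characteristic 0 1 1 0;
      characteristic 1 0 0 0; characteristic 1 0 0 1;
      characteristic 1 1 0 0; characteristic 1 1 1 1].

(* [psi4 k] has weight [4 * k]. *)
Definition psi4 (k : nat) (Z : 'M[R[i]]_2) : R[i] :=
  4^-1 * \sum_(m <- even_characteristics) theta_const m Z ^+ (4 * k).

Definition Lambda2 : set 'M[QI]_2 :=
  [set H | [/\ hermitian_mx H,
    forall j, exists n : int, H j j = (n%:~R)%:C &
    forall j l, exists n1 n2 : int, 2 * H j l = n1%:~R +i* n2%:~R]].

Definition Lambda2_ge0 : set 'M[QI]_2 :=
  [set H | Lambda2 H /\ possemidef_mx (map_mx QI_to_C H)].

Definition qpow (H : 'M[QI]_2) (Z : 'M[R[i]]_2) : R[i] :=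
  cexp (2 * pi%:C * 'i%C * \tr (map_mx QI_to_C H *m Z)).

(* Coefficient families; only the values on [Lambda2_ge0] are meaningful. *)
Definition qseries : Type := 'M[QI]_2 -> R[i].

Definition qterm (a : qseries) (Z : 'M[R[i]]_2) (H : 'M[QI]_2) : Ctop R :=
  if H \in Lambda2_ge0 then a H * qpow H Z else 0.

Definition fourier_expansion (F : 'M[R[i]]_2 -> R[i]) (a : qseries) : Prop :=
  forall Z, upper_half Z ->
    partial_sum (qterm a Z) A @[A --> totally] --> (F Z : Ctop R).

Definition theta_op (a : qseries) : qseries :=
  fun H => a H * QI_to_C (\det H).

Definition p_integral (p : nat) : set rat :=
  [set r | ~~ (p %| `|denq r|)%N].

Definition congruent_mod (p : nat) (a b : qseries) : Prop :=
  forall H, Lambda2_ge0 H ->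
    exists r s t : rat,
      [/\ p_integral p r, p_integral p s, p_integral p t,
          a H = (ratr r)%:C /\ b H = (ratr s)%:C & r - s = p%:R * t].

End Hermitian.

(* Main.v *)
Require Import Defs.
From HB Require Import structures.
From mathcomp Require Import all_boot all_order all_algebra finmap.
From mathcomp Require Import complex reals.
From mathcomp Require Import boolp classical_sets cardinality topology normedtype.
From mathcomp Require Import sequences exp trigo summability ring lra zify.

(** The idea is that theta raised to the power p + 1 is, modulo p, a sum over
    only two lattice vectors. Expanding the power, the coefficient of
    theta_m^(4k) at H counts, with signs, the 4k-tuples of shifted vectors
    v_i = g_i + omega a with (1/2) sum_i v_i v_i' = H, where v' is the
    conjugate transpose of v (sums_to_theta_power). Let 4k = p + 1 with p
    prime. The cyclic group of order p permutes the first p vectors of a tuple,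
    changing neither its Gram matrix nor its sign, so the tuples in free orbits
    contribute a multiple of p (dvdz_sum_free_orbits). A fixed tuple consists
    of p copies of a vector v and of one vector w, and then
    4 det H = det (p v v' + w w') = p |v_0 w_1 - v_1 w_0|^2
    (det_half_gram_sum). Hence for every H either p divides all the
    coefficients at H or p divides det H in Z[1/2], and in both cases p divides
    a(H) det H. This applies to every prime p = 3 mod 4
    (theta_psi4_congruence); 7 and 11 are the cases k = 2 and k = 3.

    The remaining work is to see that these numbers are the Fourier
    coefficients of psi_4k.

    - The theta series converges absolutely, being dominated by a product of
      four geometric series (bounded_sums_theta_term). So its powers may be
      expanded over tuples (sums_to_ffun) and the terms regrouped according to
      the Gram matrix (sums_to_fibres).

    - The exponents of one theta_m^(4k) need not lie in the lattice Lambda_2.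
      For a fixed first half a of the characteristic, the sum over the
      admissible second halves b of the signs (-1)^(b.s), where s_j is the parity of
      the j-th coordinate sum of the tuple, vanishes unless s satisfies the
      congruences that put the Gram matrix in Lambda_2
      (sum_theta_coef_support).

    - The coefficients of a Fourier expansion are unique, by averaging over
      translations of Z by Hermitian matrices (fourier_coefficients_eq0). *)

Set Implicit Arguments.
Unset Strict Implicit.
Unset Printing Implicit Defensive.

Import Order.TTheory GRing.Theory Num.Theory.
Import numFieldNormedType.Exports.
Import ComplexField.Normc.

Local Open Scope fset_scope.
Local Open Scope ring_scope.
Local Open Scope complex_scope.

(** * Unconditional sums of complex families *)

Section FiniteSums.
Variables (V : nmodType) (I : choiceType).
Implicit Types A B : {fset I}.

Lemma sum_fsetU_disjoint (f : I -> V) A B : [disjoint A & B]%fset ->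
  \sum_(i <- A `|` B) f i = \sum_(i <- A) f i + \sum_(i <- B) f i.
Proof.
move=> dAB; rewrite (big_fsetID _ (fun i => i \in A)) /=; congr (_ + _);
  apply: eq_fbigl => i; rewrite !inE /=.
  by case: (i \in A); rewrite ?andbF.
case: (boolP (i \in A)) => iA; rewrite ?andbF ?andbT //=.
by apply/esym/negbTE/(fdisjointP dAB).
Qed.

Lemma sum_fsetDK (f : I -> V) A B : A `<=` B ->
  \sum_(i <- B) f i = \sum_(i <- A) f i + \sum_(i <- B `\` A) f i.
Proof.
move=> sAB; rewrite -sum_fsetU_disjoint.
  by apply: eq_fbigl => i; rewrite !inE; case: (boolP (i \in A)) => // /(fsubsetP sAB) ->.
by apply/fdisjointP => i iA; rewrite inE iA.
Qed.
End FiniteSums.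

Section RealSums.
Variable R : realType.

Definition bounded_sums (I : choiceType) (f : I -> R) : Prop :=
  exists M : R, forall A : {fset I}, \sum_(i <- A) f i <= M.

(** A finite subsum within [e] of the supremum leaves at most [e] for any
    disjoint one. *)
Lemma bounded_sums_tails (I : choiceType) (f : I -> R) :
  (forall i, 0 <= f i) -> bounded_sums f ->
  forall e : R, 0 < e -> exists A0 : {fset I}, forall B : {fset I},
    [disjoint A0 & B]%fset -> \sum_(i <- B) f i <= e.
Proof.
move=> f0 [M bM] e e0.
pose E : set R := [set x | exists A : {fset I}, x = \sum_(i <- A) f i]%classic.
have hE : has_sup E.
  split; first by exists 0, fset0; rewrite big_seq_fset0.
  by exists M => x [A ->].
have [x [A ->] hA] := sup_adherent e0 hE; exists A => B dAB.
have : \sum_(i <- A `|` B) f i <= reals.sup E.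
  by apply: sup_upper_bound => //; exists (A `|` B).
by rewrite sum_fsetU_disjoint //; lra.
Qed.

Lemma bounded_sums_inj (I J : choiceType) (h : I -> J) (f : I -> R) (F : J -> R)
    (C : R) :
  injective h -> 0 <= C -> (forall i, f i <= C * F (h i)) ->
  bounded_sums F -> bounded_sums f.
Proof.
move=> injh C0 fF [M bM]; exists (C * M) => A.
apply: (@le_trans _ _ (\sum_(i <- A) C * F (h i))).
  by apply: ler_sum => i _; apply: fF.
rewrite -mulr_sumr ler_wpM2l //; apply: le_trans (bM (h @` A)).
by rewrite big_imfset //= => i j _ _; apply: injh.
Qed.

End RealSums.

Section ComplexNorm.
Variable R : realType.
Implicit Types x y z : R[i].

Lemma normc_ge0 x : 0 <= normc x.
Proof. by case: x => a b; apply: sqrtr_ge0. Qed.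

Lemma normc_real (r : R) : normc r%:C = `|r|.
Proof. by rewrite /= expr0n addr0 sqrtr_sqr. Qed.

Lemma normc_opp x : normc (- x) = normc x.
Proof. exact: normcN. Qed.

Lemma ler_normcD x y : normc (x + y) <= normc x + normc y.
Proof. exact: le_normcD. Qed.

Lemma normcX x n : normc (x ^+ n) = normc x ^+ n.
Proof.
elim: n => [|n IH]; first by rewrite !expr0 normc1.
by rewrite !exprS normcM IH.
Qed.

Lemma normc_prod (I : Type) (r : seq I) (f : I -> R[i]) :
  normc (\prod_(i <- r) f i) = \prod_(i <- r) normc (f i).
Proof.
elim/big_ind2: _ => [|x a y b <- <-|//]; first by rewrite normc1.
by rewrite normcM.
Qed.

Lemma le_normc_sum (I : Type) (r : seq I) (f : I -> R[i]) :
  normc (\sum_(i <- r) f i) <= \sum_(i <- r) normc (f i).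
Proof.
elim/big_ind2: _ => [|x a y b xa yb|//]; first by rewrite normc0.
by apply: le_trans (ler_normcD _ _) _; apply: lerD.
Qed.

Lemma le_Re_normc z : `|complex.Re z| <= normc z.
Proof.
by case: z => a b; rewrite /= -sqrtr_sqr ler_sqrt ?lerDl ?addr_ge0 ?sqr_ge0.
Qed.

Lemma le_Im_normc z : `|complex.Im z| <= normc z.
Proof.
by case: z => a b; rewrite /= -sqrtr_sqr ler_sqrt ?lerDr ?addr_ge0 ?sqr_ge0.
Qed.

Lemma le_normc_ReIm z : normc z <= `|complex.Re z| + `|complex.Im z|.
Proof.
rewrite [z in normc z]complexE; apply: le_trans (ler_normcD _ _) _.
by rewrite normcM !normc_real /= expr0n expr1n add0r sqrtr1 mul1r.
Qed.

Lemma Re_sum (I : Type) (r : seq I) (f : I -> R[i]) :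
  complex.Re (\sum_(i <- r) f i) = \sum_(i <- r) complex.Re (f i).
Proof. exact: (raddf_sum (@complex.Re R : Rcomplex R -> R)). Qed.

Lemma Im_sum (I : Type) (r : seq I) (f : I -> R[i]) :
  complex.Im (\sum_(i <- r) f i) = \sum_(i <- r) complex.Im (f i).
Proof. exact: (raddf_sum (@complex.Im R : Rcomplex R -> R)). Qed.

Lemma normc_small_eq0 z : (forall e : R, 0 < e -> normc z <= e) -> z = 0.
Proof.
move=> h; apply: eq0_normc; apply/eqP; rewrite eq_le normc_ge0 andbT.
by apply/ler_addgt0Pr => e e0; rewrite add0r h.
Qed.
End ComplexNorm.

Section ComplexSums.
#[local] Existing Instance totally_filter.
Variable R : realType.

Definition sums_to (I : choiceType) (f : I -> R[i]) (s : R[i]) : Prop :=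
  forall e : R, 0 < e -> exists A0 : {fset I}, forall A : {fset I},
    A0 `<=` A -> normc (s - \sum_(i <- A) f i) <= e.

Lemma sums_toP (I : choiceType) (f : I -> Ctop R) (s : Ctop R) :
  (partial_sum f A @[A --> totally] --> s)%classic <-> sums_to f s.
Proof.
have psE A : partial_sum f A = \sum_(i <- A) f i by rewrite big_seq_fsetE.
split=> [/cvgrPdist_le h e e0|h].
  have e0C : 0 < e%:C :> R[i] by rewrite ltcR.
  have [A0 _ hA0] := h _ e0C.
  exists A0 => A sA; have := hA0 A sA.
  by rewrite /= psE -[Num.norm _]/((normc _)%:C) lecR.
apply/cvgrPdist_le => -[e d] /=; rewrite ltcE /= => /andP[/eqP -> e0].
have [A0 hA0] := h e e0; exists A0 => // A /= /hA0.
by rewrite psE -[Num.norm _]/((normc _)%:C) lecR.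
Qed.

Lemma sums_to_sum (I : choiceType) (f : I -> R[i]) (s : R[i]) :
  sums_to f s -> summability.sum (f : I -> Ctop R) = s.
Proof. by move/sums_toP => h; apply: cvg_lim h; apply: norm_hausdorff. Qed.

Lemma eq_sums_to (I : choiceType) (f g : I -> R[i]) (s : R[i]) :
  f =1 g -> sums_to f s -> sums_to g s.
Proof.
move=> fg h e /h [A0 hA0]; exists A0 => A /hA0.
by rewrite (eq_bigr g).
Qed.

Lemma sums_toD (I : choiceType) (f g : I -> R[i]) (s t : R[i]) :
  sums_to f s -> sums_to g t -> sums_to (fun i => f i + g i) (s + t).
Proof.
move=> hf hg e e0; have e20 : 0 < e / 2 by lra.
have [A hA] := hf _ e20; have [B hB] := hg _ e20.
exists (A `|` B) => C; rewrite fsubUset => /andP[/hA h1 /hB h2].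
rewrite big_split opprD addrACA; apply: le_trans (ler_normcD _ _) _; lra.
Qed.

Lemma sums_toZ (I : choiceType) (c : R[i]) (f : I -> R[i]) (s : R[i]) :
  sums_to f s -> sums_to (fun i => c * f i) (c * s).
Proof.
move=> hf e e0; have c1 : 0 < normc c + 1 by have := normc_ge0 c; lra.
have [A hA] := hf (e / (normc c + 1)) (divr_gt0 e0 c1).
exists A => B /hA h; rewrite -mulr_sumr -mulrBr normcM.
apply: le_trans (_ : (normc c + 1) * (e / (normc c + 1)) <= _).
  by apply: ler_pM; rewrite ?normc_ge0 // lerDl ler01.
by rewrite mulrC divfK // lt0r_neq0.
Qed.

Lemma sums_to0 (I : choiceType) : sums_to (fun _ : I => 0 : R[i]) 0.
Proof.
move=> e e0; exists fset0 => A _.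
by rewrite big1 // subr0 normc0 ltW.
Qed.

Lemma sums_to_big (I : choiceType) (K : Type) (r : seq K) (f : K -> I -> R[i])
    (s : K -> R[i]) :
  (forall k, sums_to (f k) (s k)) ->
  sums_to (fun i => \sum_(k <- r) f k i) (\sum_(k <- r) s k).
Proof.
move=> h; elim: r => [|k r IH].
  by rewrite big_nil; apply: eq_sums_to (@sums_to0 I) => i; rewrite big_nil.
rewrite big_cons; apply: eq_sums_to (sums_toD (h k) IH) => i.
by rewrite big_cons.
Qed.

(** The sum of a nonnegative family is the supremum of its finite subsums. *)
Lemma sums_to_ge0 (I : choiceType) (f : I -> R) :
  (forall i, 0 <= f i) -> bounded_sums f ->
  exists s : R[i], sums_to (fun i => (f i)%:C) s.
Proof.
move=> f0 [M bM].
pose E : set R := [set x | exists A : {fset I}, x = \sum_(i <- A) f i]%classic.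
have hE : has_sup E.
  split; first by exists 0, fset0; rewrite big_seq_fset0.
  by exists M => x [A ->].
exists (reals.sup E)%:C => e e0.
have [x [A ->] hA] := sup_adherent e0 hE; exists A => B sAB.
rewrite -rmorph_sum -rmorphB normc_real.
have hB : \sum_(i <- B) f i <= reals.sup E.
  by apply: sup_upper_bound => //; exists B.
have : \sum_(i <- A) f i <= \sum_(i <- B) f i.
  by rewrite (sum_fsetDK _ sAB) lerDl sumr_ge0.
by rewrite ger0_norm; lra.
Qed.

Lemma sums_to_real (I : choiceType) (f : I -> R) :
  bounded_sums (fun i => `|f i|) ->
  exists s : R[i], sums_to (fun i => (f i)%:C) s.
Proof.
move=> bf; have [s hs] := sums_to_ge0 (fun i => normr_ge0 (f i)) bf.
have bg : bounded_sums (fun i => `|f i| - f i).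
  apply: (bounded_sums_inj (h := id) (F := fun i => `|f i|) (C := 2)) => //.
  by move=> i; have := ler_norm (- f i); rewrite normrN; lra.
have g0 i : 0 <= `|f i| - f i by have := ler_norm (f i); lra.
have [t ht] := sums_to_ge0 g0 bg.
exists (s + (-1) * t); apply: eq_sums_to (sums_toD hs (sums_toZ (-1) ht)) => i.
by rewrite rmorphB /=; ring.
Qed.

Lemma bounded_sums_sums_to (I : choiceType) (f : I -> R[i]) :
  bounded_sums (fun i => normc (f i)) -> exists s, sums_to f s.
Proof.
move=> bf.
have bg (g : I -> R) : (forall i, `|g i| <= normc (f i)) ->
    exists s : R[i], sums_to (fun i => (g i)%:C) s.
  move=> gf; apply: sums_to_real.
  apply: (bounded_sums_inj (h := id) (C := 1) _ _ _ bf) => // i.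
  by rewrite mul1r.
have [s hs] := bg _ (fun i => le_Re_normc (f i)).
have [t ht] := bg _ (fun i => le_Im_normc (f i)).
exists (s + 'i%C * t); apply: eq_sums_to (sums_toD hs (sums_toZ 'i%C ht)) => i.
by rewrite [RHS]complexE.
Qed.

Lemma bounded_sums_pos (I : choiceType) (g : I -> R) (A0 : {fset I}) (e : R) :
  (forall B : {fset I}, [disjoint A0 & B]%fset -> `|\sum_(i <- B) g i| <= e) ->
  forall B : {fset I}, [disjoint A0 & B]%fset ->
    \sum_(i <- B) `|g i| <= 2 * e.
Proof.
move=> h B dB; rewrite (big_fsetID _ (fun i => 0 <= g i)) /=.
have dB' (P : pred I) : [disjoint A0 & [fset i in B | P i]]%fset.
  apply/fdisjointP => i iA; rewrite !inE /=.
  by rewrite (negbTE (fdisjointP dB i iA)).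
have h1 := h _ (dB' (fun i => 0 <= g i)).
have h2 := h _ (dB' (fun i => ~~ (0 <= g i))).
have -> : \sum_(i <- [fset i in B | 0 <= g i]) `|g i| =
          \sum_(i <- [fset i in B | 0 <= g i]) g i.
  by apply: eq_fbigr => i; rewrite !inE /= => /andP[_ g0]; rewrite ger0_norm.
have -> : \sum_(i <- [fset i in B | ~~ (0 <= g i)]) `|g i| =
          \sum_(i <- [fset i in B | ~~ (0 <= g i)]) - g i.
  by apply: eq_fbigr => i; rewrite !inE /= -ltNge => /andP[_ g0]; rewrite ltr0_norm.
rewrite sumrN; move: h1 h2; rewrite !ler_norml => /andP[_ h1] /andP[h2 _].
lra.
Qed.

(** Outside a suitable finite set all finite subsums are small; splitting the
    real and imaginary parts by sign bounds the sums of absolute values. *)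
Lemma sums_to_bounded_sums (I : choiceType) (f : I -> R[i]) (s : R[i]) :
  sums_to f s -> bounded_sums (fun i => normc (f i)).
Proof.
move=> /(_ 1 ltr01)[A0 hA0].
have hB B : [disjoint A0 & B]%fset -> normc (\sum_(i <- B) f i) <= 2.
  move=> dB; have := hA0 _ (fsubset_refl _); have := hA0 _ (fsubsetUl A0 B).
  rewrite sum_fsetU_disjoint // => h1 h2.
  have -> : \sum_(i <- B) f i =
      (s - \sum_(i <- A0) f i) - (s - (\sum_(i <- A0) f i + \sum_(i <- B) f i)).
    by ring.
  by apply: le_trans (ler_normcD _ _) _; rewrite normc_opp; lra.
have hre := bounded_sums_pos (g := fun i => complex.Re (f i)) (A0 := A0) (e := 2).
have him := bounded_sums_pos (g := fun i => complex.Im (f i)) (A0 := A0) (e := 2).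
(* 8 = 2 * 2 + 2 * 2: subsums off [A0] are at most 2, for two coordinates and
   two signs. *)
exists (\sum_(i <- A0) normc (f i) + 8) => A.
apply: (@le_trans _ _ (\sum_(i <- A0 `|` A) normc (f i))).
  by rewrite (sum_fsetDK _ (fsubsetUr A0 A)) lerDl sumr_ge0 // => i _;
    apply: normc_ge0.
rewrite (sum_fsetDK _ (fsubsetUl A0 A)) lerD2l.
set B := (_ `\` _).
have dB : [disjoint A0 & B]%fset by apply/fdisjointP => i iA; rewrite inE iA.
apply: (@le_trans _ _ (\sum_(i <- B) (`|complex.Re (f i)| + `|complex.Im (f i)|))).
  by apply: ler_sum => i _; apply: le_normc_ReIm.
rewrite big_split /= (_ : 8 = 2 * 2 + 2 * 2 :> R); last by lra.
apply: lerD; [apply: hre => // C dC | apply: him => // C dC].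
  by rewrite -Re_sum; apply: le_trans (le_Re_normc _) (hB _ dC).
by rewrite -Im_sum; apply: le_trans (le_Im_normc _) (hB _ dC).
Qed.

Lemma sums_to_small (I : choiceType) (f : I -> R[i]) (s : R[i]) (e : R)
    (A0 : {fset I}) :
  sums_to f s ->
  (forall B : {fset I}, [disjoint A0 & B]%fset ->
     \sum_(i <- B) normc (f i) <= e) ->
  normc (s - \sum_(i <- A0) f i) <= e.
Proof.
move=> hs hB; apply/ler_addgt0Pr => d d0; have [A1 hA1] := hs d d0.
have := hA1 _ (fsubsetUr A0 A1); rewrite (sum_fsetDK _ (fsubsetUl A0 A1)).
set B := _ `\` _ => h.
have dB : [disjoint A0 & B]%fset by apply/fdisjointP => i iA; rewrite inE iA.
rewrite (_ : s - _ = (s - (\sum_(i <- A0) f i + \sum_(i <- B) f i))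
  + \sum_(i <- B) f i); last by ring.
apply: le_trans (ler_normcD _ _) _; rewrite addrC; apply: lerD => //.
by apply: le_trans (le_normc_sum _ _) (hB _ dB).
Qed.

End ComplexSums.

Section ProductsAndFibres.
Variable R : realType.

Section Box.
Variables (I : finType) (G : choiceType).

(** The functions with values in [A], that is, the power of [A] indexed by
    [I]: the boxes are cofinal among the finite sets of functions. *)
Definition fbox (A : {fset G}) : {fset {ffun I -> G}} :=
  [fset [ffun i => val ((x : {ffun I -> A}) i)] | x in {: {ffun I -> A}}].

Lemma sum_fbox (S : comPzSemiRingType) (f : G -> S) (A : {fset G}) :
  \sum_(x <- fbox A) \prod_i f (x i) = (\sum_(g <- A) f g) ^+ #|I|.
Proof.
rewrite big_imfset /=; last first.
  move=> x y _ _ /ffunP xy; apply/ffunP => i; apply: val_inj.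
  by have := xy i; rewrite !ffunE.
transitivity (\sum_(x : {ffun I -> A}) \prod_i f (val (x i))).
  rewrite big_enum /=; apply: eq_bigr => x _.
  by apply: eq_bigr => i _; rewrite ffunE.
rewrite -(bigA_distr_bigA (fun (i : I) (a : A) => f (val a))) prodr_const.
by rewrite big_seq_fsetE.
Qed.

Lemma fbox_cover (X : {fset {ffun I -> G}}) : exists A, X `<=` fbox A.
Proof.
pose A := \bigcup_(x <- X) [fset (x : {ffun I -> G}) i | i in I].
exists A; apply/fsubsetP => x xX.
have xA i : x i \in A.
  by apply/bigfcupP; exists x; rewrite ?xX //; apply/imfsetP; exists i.
apply/imfsetP; exists [ffun i => [` xA i]] => //.
by apply/ffunP => i; rewrite !ffunE.
Qed.

Lemma fboxS (A B : {fset G}) : A `<=` B -> fbox A `<=` fbox B.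
Proof.
move=> sAB; apply/fsubsetP => _ /imfsetP[x _ ->].
have xB i : val (x i) \in B by apply: (fsubsetP sAB); apply: valP.
apply/imfsetP; exists [ffun i => [` xB i]] => //.
by apply/ffunP => i; rewrite !ffunE.
Qed.

Lemma bounded_sums_ffun (f : G -> R) : (forall g, 0 <= f g) ->
  bounded_sums f -> bounded_sums (fun x : {ffun I -> G} => \prod_i f (x i)).
Proof.
move=> f0 [M bM]; exists (M ^+ #|I|) => X.
have p0 (x : {ffun I -> G}) : 0 <= \prod_i f (x i) by rewrite prodr_ge0.
have [A sXA] := fbox_cover X.
apply: (@le_trans _ _ (\sum_(x <- fbox A) \prod_i f (x i))).
  by rewrite (sum_fsetDK _ sXA) lerDl sumr_ge0.
rewrite sum_fbox; apply: lerXn2r (bM A); rewrite nnegrE ?sumr_ge0 //.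
by apply: le_trans (bM fset0); rewrite big_seq_fset0.
Qed.

Lemma exprn_close (s : R[i]) n (e : R) : 0 < e ->
  exists2 d : R, 0 < d & forall t, normc (s - t) <= d ->
    normc (s ^+ n - t ^+ n) <= e.
Proof.
move=> e0; elim: n e e0 => [|n IH] e e0.
  by exists 1 => // t _; rewrite !expr0 subrr normc0 ltW.
pose c := normc s + 1; pose b := normc (s ^+ n) + 1.
have c0 : 0 < c by rewrite /c; have := normc_ge0 s; lra.
have b0 : 0 < b by rewrite /b; have := normc_ge0 (s ^+ n); lra.
pose e' := Num.min 1 (e / 2 / c).
have e'0 : 0 < e' by rewrite lt_min ltr01 !divr_gt0.
have [d d0 hd] := IH e' e'0.
exists (Num.min d (e / 2 / b)) => [|t]; first by rewrite lt_min d0 !divr_gt0.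
rewrite le_min => /andP[/hd h1 h2].
move: h1; rewrite /e' le_min => /andP[h11 h12].
have tb : normc (t ^+ n) <= b.
  rewrite (_ : t ^+ n = s ^+ n - (s ^+ n - t ^+ n)); last by ring.
  by apply: le_trans (ler_normcD _ _) _; rewrite normc_opp /b lerD2l.
rewrite (_ : _ - _ = s * (s ^+ n - t ^+ n) + t ^+ n * (s - t)); last first.
  by rewrite !exprS; ring.
apply: le_trans (ler_normcD _ _) _; rewrite !normcM.
have -> : e = c * (e / 2 / c) + b * (e / 2 / b).
  by field; rewrite !lt0r_neq0.
apply: lerD; apply: ler_pM; rewrite ?normc_ge0 // /c; lra.
Qed.

(** On a box the identity is the distributive law, and the family of products
    has small tails outside a large box. *)
Lemma sums_to_ffun (f : G -> R[i]) (s : R[i]) : sums_to f s ->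
  sums_to (fun x : {ffun I -> G} => \prod_i f (x i)) (s ^+ #|I|).
Proof.
move=> hs e e0; have e20 : 0 < e / 2 by lra.
have bf := sums_to_bounded_sums hs.
have bF := bounded_sums_ffun (fun g => normc_ge0 (f g)) bf.
have F0 (x : {ffun I -> G}) : 0 <= \prod_i normc (f (x i)).
  by apply: prodr_ge0 => i _; apply: normc_ge0.
have [X0 hX0] := bounded_sums_tails F0 bF e20.
have [d d0 hd] := exprn_close s #|I| e20.
have [A0 hA0] := hs d d0.
have [A1 sX0] := fbox_cover X0.
exists (fbox (A0 `|` A1)) => X sX.
have sX0X : X0 `<=` fbox (A0 `|` A1).
  by apply: fsubset_trans sX0 _; apply: fboxS (fsubsetUr _ _).
rewrite (sum_fsetDK _ sX) sum_fbox opprD addrA.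
apply: le_trans (ler_normcD _ _) _; rewrite normc_opp.
have h1 := hd _ (hA0 _ (fsubsetUl A0 A1)).
set B := X `\` _.
have h2 : normc (\sum_(x <- B) \prod_i f (x i)) <= e / 2.
  apply: le_trans (le_normc_sum _ _) _.
  under eq_bigr do rewrite normc_prod.
  apply: hX0; apply/fdisjointP => x xX0.
  by rewrite inE (fsubsetP sX0X _ xX0).
lra.
Qed.
End Box.

Lemma sums_to_fibres (I J : choiceType) (h : I -> J) (fib : J -> {fset I})
    (f : I -> R[i]) (s : R[i]) :
  (forall i j, (i \in fib j) = (h i == j)) -> sums_to f s ->
  sums_to (fun j => \sum_(i <- fib j) f i) s.
Proof.
move=> hfib hs e /hs[A0 hA0]; exists (h @` A0) => B sB.
have := hA0 (\bigcup_(j <- B) fib j); rewrite partition_disjoint_bigfcup /=.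
  apply; apply/fsubsetP => i iA0; apply/bigfcupP; exists (h i).
    by rewrite andbT (fsubsetP sB) // in_imfset.
  by rewrite hfib.
move=> j k _ _ jk; apply/fdisjointP => i; rewrite !hfib => /eqP ->.
exact: jk.
Qed.

(** [#|P| c] is at most the bound of the sums. *)
Lemma finite_level_set (I : choiceType) (f : I -> R) (P : set I) (c : R) :
  bounded_sums f -> 0 < c -> (forall i, P i -> c <= f i) -> finite_set P.
Proof.
move=> [M bM] c0 hP; apply: contrapT => /infinite_set_fset.
move=> /(_ (Num.bound (M / c)))[B sBP hB].
have M0 : 0 <= M by have := bM fset0; rewrite big_seq_fset0.
have := bM B; apply/negP; rewrite -ltNge.
apply: (@lt_le_trans _ _ (\sum_(i <- B) c)); last first.
  by rewrite big_seq [leRHS]big_seq; apply: ler_sum => i iB; apply/hP/sBP.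
rewrite big_const_seq count_predT iter_addr_0 -mulr_natr mulrC.
rewrite -ltr_pdivrMr //; apply: lt_le_trans (_ : (Num.bound (M / c))%:R <= _).
  by apply: archi_boundP; rewrite divr_ge0 // ltW.
by rewrite ler_nat.
Qed.

Lemma bounded_sums_geometric (q : R) : 0 <= q -> q < 1 ->
  bounded_sums (fun n : nat => q ^+ n).
Proof.
move=> q0 q1; exists (1 - q)^-1 => A.
have {1}-> : (1 - q)^-1 = 1 / (1 - q) by rewrite mul1r.
have key N (B : {fset nat}) : (forall n, n \in B -> (n < N)%N) ->
    \sum_(n <- B) q ^+ n <= \sum_(n < N) q ^+ n.
  elim: N B => [|N IH] B hB.
    rewrite (_ : B = fset0) ?big_seq_fset0 ?big_ord0 //.
    by apply/fsetP => n; rewrite in_fset0; apply/negP => /hB.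
  rewrite big_ord_recr /=; case: (boolP (N \in B)) => NB.
    rewrite (big_fsetD1 N NB) /= addrC lerD2r; apply: IH => n.
    by rewrite !inE => /andP[nN /hB]; rewrite ltnS leq_eqVlt (negbTE nN).
  apply: ler_wpDr; first exact: exprn_ge0.
  apply: IH => n nB; have := hB n nB; rewrite ltnS leq_eqVlt.
  by case/orP => // /eqP nN; rewrite nN (negbTE NB) in nB.
rewrite ler_pdivlMr ?subr_gt0 //.
apply: (@le_trans _ _ ((\sum_(n < (\max_(n <- A) n)%N.+1) q ^+ n) * (1 - q))).
  apply: ler_wpM2r; first by rewrite subr_ge0 ltW.
  apply: key => n nA; by rewrite ltnS; apply: leq_bigmax_seq.
rewrite mulrC -opprB mulNr -subrX1 opprB.
by rewrite lerBlDr lerDl exprn_ge0.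
Qed.

Lemma bounded_sums_int (c : R) : 0 < c ->
  bounded_sums (fun n : int => expR (- (c * `|n|%:~R))).
Proof.
move=> c0.
(* The integers are interleaved into [nat] by [n |-> 2 n] and
   [- n - 1 |-> 2 n + 1], a code that is at most [2 `|n|]. *)
have h : injective (fun n : int =>
    match n with Posz m => m.*2 | Negz m => m.*2.+1 end).
  by move=> [m|m] [n|n] // => [/double_inj ->|e|e|[] /double_inj ->] //;
    have := congr1 odd e; rewrite /= !odd_double.
apply: (bounded_sums_inj (C := 1) h _ _
  (bounded_sums_geometric (q := expR (- (c / 2))) _ _)).
- exact: ler01.
- move=> n; rewrite mul1r -expRM_natl ler_expR.
  case: n => m; rewrite -abszE /= -pmulrn.
    by rewrite -muln2 natrM; lra.
  rewrite -[m.+1%:R]natr1 -[m.*2.+1%:R]natr1 -muln2 natrM; lra.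
- exact: expR_ge0.
- by rewrite expR_lt1 oppr_lt0 divr_gt0.
Qed.

End ProductsAndFibres.

(** * The terms of the theta series *)

Section ComplexExponential.
Variable R : realType.

Lemma cexpD (z w : R[i]) : cexp (z + w) = cexp z * cexp w.
Proof.
case: z w => [a b] [c d]; rewrite /cexp /= expRD cosD sinD.
by simpc; congr (_ +i* _); ring.
Qed.

Lemma cexp0 : cexp (0 : R[i]) = 1.
Proof. by rewrite /cexp /= expR0 cos0 sin0 mul1r. Qed.

Lemma normc_cexp (z : R[i]) : normc (cexp z) = expR (complex.Re z).
Proof.
rewrite normcM normc_real ger0_norm ?expR_ge0 //= cos2Dsin2 sqrtr1.
by rewrite mulr1.
Qed.

Lemma cexp_pi_int (n : int) :
  cexp (pi%:C * 'i%C * (n%:~R)%:C) = ((-1) ^+ `|n|%N : int)%:~R :> R[i].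
Proof.
have e1 (m : nat) : cexp (pi%:C * 'i%C * m%:R) = (-1) ^+ m :> R[i].
  elim: m => [|m IH]; first by rewrite mulr0 cexp0.
  rewrite -addn1 natrD mulrDr cexpD IH exprD; congr (_ * _).
  have -> : pi%:C * 'i%C * 1 = 0 +i* pi :> R[i] by simpc.
  by rewrite /cexp /= expR0 cospi sinpi mul1r expr1 -(rmorphN1 (real_complex R)).
have e2 (m : nat) : cexp (- (pi%:C * 'i%C * m%:R)) = (-1) ^+ m :> R[i].
  apply: (mulfI (x := (-1) ^+ m)); first by rewrite expf_eq0 oppr_eq0 oner_eq0 andbF.
  by rewrite -{1}e1 -cexpD subrr cexp0 -exprD addnn -mul2n exprM sqrrN !expr1n.
rewrite rmorph_int rmorphXn rmorphN1.
case: n => m /=; first by rewrite -pmulrn e1.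
by rewrite NegzE mulrNz mulrN -pmulrn e2.
Qed.

End ComplexExponential.

Section Embedding.
Variable R : realType.

Lemma natC2 : (2 : R[i]) = 2%:C.
Proof. by rewrite rmorph_nat. Qed.

Lemma QI_to_C_is_additive : {morph @QI_to_C R : x y / x - y}.
Proof. by move=> [a b] [c d]; rewrite /QI_to_C /= !rmorphD !rmorphN. Qed.

Lemma QI_to_C_is_multiplicative : GRing.monoid_morphism (@QI_to_C R).
Proof.
split=> [|[a b] [c d]]; rewrite /QI_to_C /=; first by rewrite rmorph1 rmorph0.
by rewrite rmorphB rmorphD !rmorphM.
Qed.

HB.instance Definition _ := GRing.isZmodMorphism.Build QI R[i] (@QI_to_C R)
  QI_to_C_is_additive.
HB.instance Definition _ := GRing.isMonoidMorphism.Build QI R[i] (@QI_to_C R)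
  QI_to_C_is_multiplicative.

Lemma QI_to_C_conj (x : QI) : QI_to_C R (conjc x) = conjc (QI_to_C R x).
Proof. by case: x => a b; rewrite /QI_to_C /= rmorphN. Qed.

Lemma map_QI_to_C_conjtr m n (A : 'M[QI]_(m, n)) :
  map_mx (@QI_to_C R) (conjtr A) = conjtr (map_mx (@QI_to_C R) A).
Proof. by apply/matrixP => i j; rewrite !mxE QI_to_C_conj. Qed.

Definition gaussQ (x : gauss_int) : QI :=
  (complex.Re x)%:~R +i* (complex.Im x)%:~R.

Definition omegaQ : QI := 2^-1 +i* 2^-1.

Lemma QI_to_C_gaussQ x : QI_to_C R (gaussQ x) = gauss_to_C R x.
Proof. by rewrite /QI_to_C /gauss_to_C /= !ratr_int. Qed.

Lemma QI_to_C_omegaQ : QI_to_C R omegaQ = omega R.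
Proof.
rewrite /QI_to_C /= fmorphV rmorph_nat /omega.
apply/(canRL (mulfK _)); first by rewrite pnatr_eq0.
rewrite natC2.
by simpc; rewrite mulVf ?pnatr_eq0.
Qed.

Lemma conjtrM m n p (A : 'M[R[i]]_(m, n)) (B : 'M[R[i]]_(n, p)) :
  conjtr (A *m B) = conjtr B *m conjtr A.
Proof. by rewrite /conjtr trmx_mul map_mxM. Qed.

Lemma conjtrK m n (A : 'M[R[i]]_(m, n)) : conjtr (conjtr A) = A.
Proof. by apply/matrixP => i j; rewrite !mxE conjcK. Qed.

Lemma conjtr_herm_act m n (A : 'M[R[i]]_m) (B : 'M[R[i]]_(m, n)) :
  conjtr (herm_act A B) = herm_act (conjtr A) B.
Proof. by rewrite /herm_act !conjtrM conjtrK mulmxA. Qed.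

End Embedding.

Section ThetaTerms.
Variable R : realType.
Notation G := 'cV[gauss_int]_2.

(** [g + (1 + i)/2 a], over the Gaussian rationals, where exponents live. *)
Definition shifted (a g : G) : 'cV[QI]_2 :=
  map_mx gaussQ g + omegaQ *: map_mx gaussQ a.

(** The exponent of the theta term at [v]: [pi i Z{v} = 2 pi i tr(H Z)] for
    [H = 1/2 v v'], with [v'] the conjugate transpose. *)
Definition half_gram (v : 'cV[QI]_2) : 'M[QI]_2 := 2^-1 *: (v *m conjtr v).

(** [2 Re ((1 + i)/2 z) = Re z - Im z], at [z = sum_j b_j g_j]. *)
Definition theta_exponent (b g : G) : int :=
  \sum_j (complex.Re (b j 0) * (complex.Re (g j 0) - complex.Im (g j 0))
          - complex.Im (b j 0) * (complex.Re (g j 0) + complex.Im (g j 0))).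

Definition theta_sign (b g : G) : int := (-1) ^+ `|theta_exponent b g|%N.

Lemma qpowD (A B : 'M[QI]_2) (Z : 'M[R[i]]_2) :
  qpow (A + B) Z = qpow A Z * qpow B Z.
Proof. by rewrite /qpow map_mxD mulmxDl mxtraceD mulrDr cexpD. Qed.

Lemma qpow0 (Z : 'M[R[i]]_2) : qpow 0 Z = 1.
Proof. by rewrite /qpow map_mx0 mul0mx mxtrace0 mulr0 cexp0. Qed.

Lemma qpow_sum (I : Type) (r : seq I) (A : I -> 'M[QI]_2) (Z : 'M[R[i]]_2) :
  qpow (\sum_(i <- r) A i) Z = \prod_(i <- r) qpow (A i) Z.
Proof.
by elim/big_rec2: _ => [|i x y _ <-]; rewrite ?qpow0 // qpowD.
Qed.

Lemma normc_qpow (A : 'M[QI]_2) (Z : 'M[R[i]]_2) :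
  normc (qpow A Z) =
  expR (- (2 * pi * complex.Im (\tr (map_mx (@QI_to_C R) A *m Z)))).
Proof.
rewrite normc_cexp; congr expR; case: (\tr _) => x y.
rewrite natC2.
by simpc => /=; ring.
Qed.

Lemma half_gram_trace (v : 'cV[QI]_2) (Z : 'M[R[i]]_2) :
  2 * \tr (map_mx (@QI_to_C R) (half_gram v) *m Z) =
  herm_act Z (map_mx (@QI_to_C R) v) 0 0.
Proof.
rewrite /half_gram map_mxZ map_mxM map_QI_to_C_conjtr -scalemxAl linearZ /=.
rewrite fmorphV rmorph_nat mulrA divff ?pnatr_eq0 // mul1r -mulmxA mxtrace_mulC.
by rewrite /herm_act /mxtrace big_ord1.
Qed.

Lemma map_shifted (a g : G) : map_mx (@QI_to_C R) (shifted a g) =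
  map_mx (@gauss_to_C R) g + omega R *: map_mx (@gauss_to_C R) a.
Proof.
rewrite map_mxD map_mxZ /= QI_to_C_omegaQ.
by congr (_ + _ *: _); apply/matrixP => i j; rewrite !mxE QI_to_C_gaussQ.
Qed.

Lemma theta_termE (a b : G) (Z : 'M[R[i]]_2) (g : G) :
  theta_term a b Z g =
  (theta_sign b g)%:~R * qpow (half_gram (shifted a g)) Z.
Proof.
rewrite /theta_term mulrDr cexpD mulrC; congr (_ * _); last first.
  rewrite /qpow -map_shifted -half_gram_trace; congr cexp; ring.
rewrite -cexp_pi_int; congr (cexp (_ * _)).
rewrite natC2.
rewrite -rmorphM; congr (_%:C); rewrite !mxE /theta_exponent mulr_sumr Re_sum.
rewrite rmorph_sum mulr_sumr; apply: eq_bigr => j _; rewrite !mxE /gauss_to_C.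
rewrite -QI_to_C_omegaQ /omegaQ /QI_to_C /= fmorphV rmorph_nat.
by rewrite !(rmorphB, rmorphD, rmorphM) /=; field.
Qed.

End ThetaTerms.

(** * Absolute convergence of the theta series *)

Section Convergence.
Variable R : realType.
Notation G := 'cV[gauss_int]_2.

Lemma herm_act_imag (Z : 'M[R[i]]_2) (v : 'cV[R[i]]_2) :
  herm_act ((2 * 'i%C)^-1 *: (Z - conjtr Z)) v 0 0 =
  (complex.Im (herm_act Z v 0 0))%:C.
Proof.
have -> : herm_act ((2 * 'i%C)^-1 *: (Z - conjtr Z)) v =
    (2 * 'i%C)^-1 *: (herm_act Z v - conjtr (herm_act Z v)).
  rewrite conjtr_herm_act /herm_act -scalemxAr -scalemxAl.
  by rewrite mulmxBr mulmxBl.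
rewrite !mxE subcJ [2 * _ * _]mulrAC mulKf //.
by rewrite mulf_neq0 ?pnatr_eq0 // eq_complex /= oner_eq0 andbF.
Qed.

(** Evaluating the form at the two basis vectors and at [(- Y_01, Y_00)] gives
    the positivity of the diagonal entries and of the determinant. *)
Lemma posdef_mx_coords (Y : 'M[R[i]]_2) : posdef_mx Y ->
  exists a d p q : R, [/\ 0 < a, 0 < d, 0 < a * d - (p ^+ 2 + q ^+ 2) &
   forall v : 'cV[R[i]]_2, complex.Re (herm_act Y v 0 0) =
    a * (complex.Re (v 0 0) ^+ 2 + complex.Im (v 0 0) ^+ 2) +
    d * (complex.Re (v 1 0) ^+ 2 + complex.Im (v 1 0) ^+ 2) +
    2 * (p * (complex.Re (v 0 0) * complex.Re (v 1 0)
              + complex.Im (v 0 0) * complex.Im (v 1 0)) +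
         q * (complex.Im (v 0 0) * complex.Re (v 1 0)
              - complex.Re (v 0 0) * complex.Im (v 1 0)))].
Proof.
move=> [hY pY].
have hE (v : 'cV[R[i]]_2) : herm_act Y v 0 0 =
    conjc (v 0 0) * Y 0 0 * v 0 0 + conjc (v 1 0) * Y 1 0 * v 0 0
    + (conjc (v 0 0) * Y 0 1 * v 1 0 + conjc (v 1 0) * Y 1 1 * v 1 0).
  rewrite /herm_act !mxE !big_ord_recl !big_ord0 !mxE !big_ord_recl !big_ord0.
  rewrite !mxE /= !addr0 !mulrDl.
  by rewrite (_ : lift ord0 ord0 = 1 :> 'I_2) ; last exact: val_inj.
have [a Y00] : exists a, Y 0 0 = a%:C.
  have := congr1 (fun M : 'M_2 => M 0 0) hY; rewrite !mxE /=.
  case: (Y 0 0) => x y [] /= yE; exists x; congr (_ +i* _); lra.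
have [d Y11] : exists d, Y 1 1 = d%:C.
  have := congr1 (fun M : 'M_2 => M 1 1) hY; rewrite !mxE /=.
  case: (Y 1 1) => x y [] /= yE; exists x; congr (_ +i* _); lra.
have [p [q Y01]] : exists p q, Y 0 1 = p +i* q.
  by case: (Y 0 1) => x y; exists x, y.
have Y10 : Y 1 0 = p +i* (- q).
  by have := congr1 (fun M : 'M_2 => M 1 0) hY; rewrite !mxE /= Y01.
pose vec (x y : R[i]) : 'cV[R[i]]_2 := \col_j (if j == 0 then x else y).
have vec0 x y : vec x y 0 0 = x by rewrite mxE.
have vec1 x y : vec x y 1 0 = y by rewrite mxE.
have vecN0 x y : (x != 0) || (y != 0) -> vec x y != 0.
  move=> h; apply/eqP => /matrixP e; have := e 0 0; have := e 1 0.
  by rewrite vec0 vec1 !mxE => y0 x0; rewrite x0 y0 eqxx in h.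
have {}hE (v : 'cV[R[i]]_2) : complex.Re (herm_act Y v 0 0) =
    a * (complex.Re (v 0 0) ^+ 2 + complex.Im (v 0 0) ^+ 2) +
    d * (complex.Re (v 1 0) ^+ 2 + complex.Im (v 1 0) ^+ 2) +
    2 * (p * (complex.Re (v 0 0) * complex.Re (v 1 0)
              + complex.Im (v 0 0) * complex.Im (v 1 0)) +
         q * (complex.Im (v 0 0) * complex.Re (v 1 0)
              - complex.Re (v 0 0) * complex.Im (v 1 0))).
  rewrite hE Y00 Y01 Y10 Y11; case: (v 0 0) (v 1 0) => x1 y1 [x2 y2] /=; ring.
have pRe (v : 'cV[R[i]]_2) : v != 0 -> 0 < complex.Re (herm_act Y v 0 0).
  by move=> v0; have := pY v v0; rewrite ltcE => /andP[].
have a0 : 0 < a.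
  have := pRe _ (vecN0 1 0 _); rewrite oner_eq0 => /(_ isT).
  by rewrite hE vec0 vec1 /=; lra.
have d0 : 0 < d.
  have := pRe _ (vecN0 0 1 _); rewrite oner_eq0 orbT => /(_ isT).
  by rewrite hE vec0 vec1 /=; lra.
exists a, d, p, q; split => //.
have := pRe _ (vecN0 (- p +i* - q) a%:C _).
rewrite [in X in X -> _]orbC eq_complex /= (gt_eqF a0) /= => /(_ isT).
rewrite hE vec0 vec1 /= => h; rewrite -(pmulr_rgt0 _ a0); nra.
Qed.

(** [det Y / tr Y] is a lower bound for the smaller eigenvalue of [Y]. *)
Lemma posdef_mx_lower_bound (Y : 'M[R[i]]_2) : posdef_mx Y ->
  exists2 e : R, 0 < e & forall v : 'cV[R[i]]_2,
    e * (\sum_(j < 2) (complex.Re (v j 0) ^+ 2 + complex.Im (v j 0) ^+ 2))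
    <= complex.Re (herm_act Y v 0 0).
Proof.
move=> /posdef_mx_coords[a [d [p [q [a0 d0 D0 hE]]]]].
pose e := (a * d - (p ^+ 2 + q ^+ 2)) / (a + d).
have ad0 : 0 < a + d by rewrite addr_gt0.
have eE : e * (a + d) = a * d - (p ^+ 2 + q ^+ 2) by rewrite divfK ?lt0r_neq0.
have e0 : 0 < e by rewrite divr_gt0.
exists e => // v; rewrite hE !big_ord_recl big_ord0 addr0.
rewrite (_ : lift ord0 ord0 = 1); last exact: val_inj.
case: (v 0 0) (v 1 0) => x1 y1 [x2 y2] /=.
have ae : 0 < a - e.
  rewrite -(pmulr_lgt0 _ ad0) mulrBl eE.
  by have := sqr_ge0 p; have := sqr_ge0 q; nra.
rewrite -subr_ge0 -(pmulr_rge0 _ ae).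
have := sqr_ge0 ((a - e) * x1 + p * x2 - q * y2).
have := sqr_ge0 ((a - e) * y1 + p * y2 + q * x2).
have := mulr_ge0 (sqr_ge0 e) (sqr_ge0 x2).
have := mulr_ge0 (sqr_ge0 e) (sqr_ge0 y2).
set s1 := e ^+ 2 * _; set s2 := e ^+ 2 * _; set s3 := _ ^+ 2; set s4 := _ ^+ 2.
move=> h1 h2 h3 h4.
(* With [e (a + d) = det Y] the form [Y - e] has determinant [e ^ 2], whence
   the completed squares. *)
suff -> : (a - e) * (a * (x1 ^+ 2 + y1 ^+ 2) + d * (x2 ^+ 2 + y2 ^+ 2) +
   2 * (p * (x1 * x2 + y1 * y2) + q * (y1 * x2 - x1 * y2)) -
   e * (x1 ^+ 2 + y1 ^+ 2 + (x2 ^+ 2 + y2 ^+ 2))) = s1 + s2 + s3 + s4.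
  by rewrite !addr_ge0.
rewrite /s1 /s2 /s3 /s4.
apply/eqP; rewrite -subr_eq0; apply/eqP.
transitivity ((x2 ^+ 2 + y2 ^+ 2) *
  (a * d - (p ^+ 2 + q ^+ 2) - e * (a + d))); first by ring.
by rewrite eE subrr mulr0.
Qed.
End Convergence.

Section ThetaConvergence.
Variable R : realType.
Notation G := 'cV[gauss_int]_2.

Lemma normc_theta_sign (b g : G) : normc ((theta_sign b g)%:~R : R[i]) = 1.
Proof.
rewrite /theta_sign rmorphXn rmorphN1 normcX normc_opp.
by rewrite (_ : normc 1 = 1 :> R) ?expr1n //; exact: normc1.
Qed.

Lemma normc_qpow_half_gram (v : 'cV[QI]_2) (Z : 'M[R[i]]_2) :
  normc (qpow (half_gram v) Z) = expR (- (pi * complex.Re (herm_act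
    ((2 * 'i%C)^-1 *: (Z - conjtr Z)) (map_mx (@QI_to_C R) v) 0 0))).
Proof.
rewrite normc_qpow herm_act_imag /= -half_gram_trace; congr (expR (- _)).
by rewrite natC2; case: (\tr _) => x y /=; ring.
Qed.

Definition gauss_coords (g : G) : {ffun 'I_2 * bool -> int} :=
  [ffun k => if k.2 then complex.Re (g k.1 0) else complex.Im (g k.1 0)].

Lemma gauss_coords_inj : injective gauss_coords.
Proof.
move=> g h /ffunP e; apply/matrixP => j k; rewrite ord1.
have := e (j, true); have := e (j, false); rewrite !ffunE /=.
by case: (g j 0) (h j 0) => x y [z t] /= -> ->.
Qed.

Lemma sum_coords (V : nmodType) (f : 'I_2 * bool -> V) :
  \sum_(j < 2) (f (j, true) + f (j, false)) = \sum_k f k.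
Proof.
transitivity (\sum_(j < 2) \sum_(b : bool) f (j, b)).
  by apply: eq_bigr => j _; rewrite big_bool.
by rewrite pair_bigA; apply: eq_bigr => -[].
Qed.

(** The four real coordinates [t] of [g + (1 + i)/2 a] are translates of
    integers [x], and [t ^ 2 >= |x| - const], so the series is dominated by a
    product of four geometric series. *)
Lemma bounded_sums_theta_term (a b : G) (Z : 'M[R[i]]_2) : upper_half Z ->
  bounded_sums (fun g => normc (theta_term a b Z g)).
Proof.
move=> /posdef_mx_lower_bound[e e0 he].
have pe0 : 0 < pi * e by rewrite mulr_gt0 ?pi_gt0.
pose w := omega R *: map_mx (@gauss_to_C R) a.
pose al (k : 'I_2 * bool) : R :=
  if k.2 then complex.Re (w k.1 0) else complex.Im (w k.1 0).
pose K := \sum_k (`|al k| + 1).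
have hb := @bounded_sums_ffun R ('I_2 * bool)%type int _
  (fun n => expR_ge0 _) (bounded_sums_int pe0).
apply: (bounded_sums_inj (C := expR (pi * e * K)) gauss_coords_inj _ _ hb).
  exact: expR_ge0.
move=> g; rewrite theta_termE normcM normc_theta_sign mul1r normc_qpow_half_gram.
rewrite -expR_sum -expRD ler_expR sumrN -mulr_sumr.
rewrite -mulrBr lerNl -mulrN [- (_ - _)]opprB -mulrA ler_pM2l ?pi_gt0 //.
apply: le_trans (he _); rewrite ler_pM2l // map_shifted -/w.
pose t (k : 'I_2 * bool) : R := (gauss_coords g k)%:~R + al k.
have -> : \sum_(j < 2) (complex.Re ((map_mx (@gauss_to_C R) g + w) j 0) ^+ 2 +
    complex.Im ((map_mx (@gauss_to_C R) g + w) j 0) ^+ 2) = \sum_k t k ^+ 2.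
  rewrite -sum_coords; apply: eq_bigr => j _; rewrite /t /al !ffunE /= [in LHS]mxE.
  by rewrite [map_mx _ g j 0]mxE; case: (w j 0).
rewrite /K -sumrB; apply: ler_sum => k _; rewrite /t.
move: (gauss_coords g k) (al k) => n c.
rewrite intr_norm; move: (n%:~R : R) => x.
(* [u ^ 2 - u + 1 > 0] for [u = `|x + c|]. *)
have h1 : `|x| <= `|x + c| + `|c|.
  by rewrite -{1}(addrK c x); apply: le_trans (ler_normB _ _) _.
rewrite -(real_normK (num_real (x + c))); move: h1 (normr_ge0 (x + c)).
set u := `|x + c|; nra.
Qed.

Lemma sums_to_theta_const (a b : G) (Z : 'M[R[i]]_2) : upper_half Z ->
  sums_to (theta_term a b Z) (theta_const (a, b) Z).
Proof.
move=> hZ; have [s hs] := bounded_sums_sums_to (bounded_sums_theta_term a b hZ).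
by rewrite /theta_const (sums_to_sum hs).
Qed.

Section Powers.
Variable I : finType.

Definition gram_sum (a : G) (x : {ffun I -> G}) : 'M[QI]_2 :=
  \sum_i half_gram (shifted a (x i)).

Definition sign_prod (b : G) (x : {ffun I -> G}) : int :=
  \prod_i theta_sign b (x i).

Lemma prod_theta_term (a b : G) (Z : 'M[R[i]]_2) (x : {ffun I -> G}) :
  \prod_i theta_term a b Z (x i) =
  (sign_prod b x)%:~R * qpow (gram_sum a x) Z.
Proof.
rewrite /sign_prod /gram_sum qpow_sum rmorph_prod -big_split /=.
by apply: eq_bigr => i _; rewrite theta_termE.
Qed.

End Powers.
End ThetaConvergence.

(** * Uniqueness of Fourier coefficients *)

Section RealPoints.
Variable R : realType.
Implicit Types X Y Z : 'M[R[i]]_2.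

Lemma conjtrD m n (A B : 'M[R[i]]_(m, n)) : conjtr (A + B) = conjtr A + conjtr B.
Proof. by rewrite /conjtr linearD map_mxD. Qed.

Lemma conjtrZ m n (c : R[i]) (A : 'M[R[i]]_(m, n)) :
  conjtr (c *: A) = conjc c *: conjtr A.
Proof. by rewrite /conjtr linearZ map_mxZ. Qed.

Lemma mxtrace_conjtr n (A : 'M[R[i]]_n) : \tr (conjtr A) = conjc (\tr A).
Proof. by rewrite /conjtr trace_map_mx mxtrace_tr. Qed.

Lemma herm_act1 n (v : 'cV[R[i]]_n) :
  herm_act 1%:M v 0 0 = \sum_j `|v j 0| ^+ 2.
Proof.
rewrite /herm_act mulmx1 mxE; apply: eq_bigr => j _; rewrite !mxE mulrC.
rewrite -add_Re2_Im2; case: (v j 0) => x y; simpc.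
by rewrite !expr2 addrC [y * x]mulrC addNr addrC.
Qed.

Lemma posdef_mx1 n : posdef_mx (1%:M : 'M[R[i]]_n).
Proof.
split=> [|v vN0].
  by rewrite /hermitian_mx /conjtr trmx1 map_mx1.
rewrite herm_act1 lt_def sumr_ge0 ?andbT; last first.
  by move=> j _; rewrite exprn_ge0.
apply: contra vN0 => /eqP/psumr_eq0P h; apply/eqP/matrixP => j k.
rewrite ord1 mxE; apply/eqP; rewrite -normr_eq0 -sqrf_eq0 h // => l _.
by rewrite exprn_ge0.
Qed.

Lemma upper_half_addi X : hermitian_mx X -> upper_half (X + 'i%C%:M).
Proof.
move=> hX; rewrite /upper_half /= conjtrD hX -scalemx1 conjtrZ.
rewrite (_ : conjtr 1%:M = 1%:M); last by rewrite /conjtr trmx1 map_mx1.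
rewrite opprD addrACA subrr add0r -scalerBl scalerA.
rewrite (_ : _ * _ = 1) ?scale1r; first exact: posdef_mx1.
rewrite subcJ /= mulr1 mulVf // mulf_neq0 ?pnatr_eq0 //.
by rewrite eq_complex /= oner_eq0 andbF.
Qed.

Lemma qpowDr (H : 'M[QI]_2) Y Z : qpow H (Y + Z) = qpow H Y * qpow H Z.
Proof. by rewrite /qpow mulmxDr mxtraceD mulrDr cexpD. Qed.

Lemma qpow_neq0 (H : 'M[QI]_2) Z : qpow H Z != 0.
Proof.
apply: contraPneq (expR_gt0 (- (2 * pi * complex.Im
  (\tr (map_mx (@QI_to_C R) H *m Z))))).
by rewrite -normc_qpow => ->; rewrite normc0 ltxx.
Qed.

Lemma hermitian_map_QI (H : 'M[QI]_2) :
  hermitian_mx H -> hermitian_mx (map_mx (@QI_to_C R) H).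
Proof. by rewrite /hermitian_mx -map_QI_to_C_conjtr => ->. Qed.

Lemma Im_trace_herm (A B : 'M[R[i]]_2) : hermitian_mx A -> hermitian_mx B ->
  complex.Im (\tr (A *m B)) = 0.
Proof.
move=> hA hB; have : conjc (\tr (A *m B)) = \tr (A *m B).
  by rewrite -mxtrace_conjtr conjtrM hA hB mxtrace_mulC.
by case: (\tr _) => x y [] /=; lra.
Qed.

Lemma normc_qpow_herm (H : 'M[QI]_2) Y :
  hermitian_mx H -> hermitian_mx Y -> normc (qpow H Y) = 1.
Proof.
move=> hH hY; rewrite normc_qpow Im_trace_herm ?mulr0 ?oppr0 ?expR0 //.
exact: hermitian_map_QI.
Qed.

Lemma trace_herm_sqr_neq0 (D : 'M[R[i]]_2) : hermitian_mx D -> D != 0 ->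
  \tr (D *m D) != 0.
Proof.
move=> hD; apply: contra => /eqP; rewrite -{1}hD /mxtrace => h.
have {}h : \sum_i \sum_j `|D j i| ^+ 2 = 0.
  rewrite -[RHS]h; apply: eq_bigr => i _; rewrite mxE; apply: eq_bigr => j _.
  rewrite !mxE mulrC -add_Re2_Im2.
  by case: (D j i) => x y; simpc; rewrite !expr2 addrC [y * x]mulrC addNr addrC.
apply/eqP/matrixP => j i; rewrite mxE; apply/eqP; rewrite -normr_eq0 -sqrf_eq0.
have h0 k : 0 <= \sum_l `|D l k| ^+ 2 by apply: sumr_ge0 => l _; rewrite exprn_ge0.
have /psumr_eq0P -> // : \sum_j `|D j i| ^+ 2 = 0.
  by move/psumr_eq0P: h => ->.
by move=> l _; rewrite exprn_ge0.
Qed.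

(** For [D = H - H0] the direction [Y = D / (2 tr(D D))] has
    [tr(H Y) - tr(H0 Y) = 1/2]. *)
Lemma separating_direction (H H0 : 'M[QI]_2) :
  hermitian_mx H -> hermitian_mx H0 -> H != H0 ->
  exists2 Y : 'M[R[i]]_2, hermitian_mx Y & qpow H Y = - qpow H0 Y.
Proof.
move=> hH hH0 HH0.
pose D := map_mx (@QI_to_C R) (H - H0).
have DE : D = map_mx (@QI_to_C R) H - map_mx (@QI_to_C R) H0 by rewrite /D map_mxB.
have hD : hermitian_mx D.
  rewrite /hermitian_mx DE -scaleN1r conjtrD conjtrZ.
  by rewrite !(hermitian_map_QI hH) (hermitian_map_QI hH0) rmorphN1.
have D0 : D != 0.
  rewrite /D map_mx_eq0 ?subr_eq0 //.
have t0 := trace_herm_sqr_neq0 hD D0.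
pose c := (2 * \tr (D *m D))^-1.
have hc : conjc c = c.
  by rewrite /c conjc_inv rmorphM rmorph_nat /= -mxtrace_conjtr conjtrM hD.
exists (c *: D); first by rewrite /hermitian_mx conjtrZ hc hD.
have -> : H = H0 + (H - H0) by rewrite addrC subrK.
rewrite qpowD -[RHS]mulr1 mulNr -mulrN; congr (_ * _).
rewrite /qpow -/D -scalemxAr linearZ /=.
have -> : 2 * pi%:C * 'i%C * (c * \tr (D *m D)) = pi%:C * 'i%C * (1%:~R)%:C.
  rewrite /c /=; move: (\tr _) t0 => t t0; by field.
by rewrite cexp_pi_int /= expr1 rmorphN1.
Qed.

End RealPoints.

Section Uniqueness.
Variable R : realType.

(** [1/2 (1 + c q^H(Y))]: averaging the translates of a Fourier series by
    [0] and [Y], the latter with weight [c], kills the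
    exponents [H] with [c q^H(Y) = -1] and keeps those with [c q^H(Y) = 1].
    Each factor is such an average. *)
Definition averaging_weight (s : seq ('M[R[i]]_2 * R[i])) (H : 'M[QI]_2) : R[i] :=
  \prod_(k <- s) (2^-1 * (1 + k.2 * qpow H k.1)).

Lemma sums_to_averaging (u : 'M[QI]_2 -> R[i]) (s : seq ('M[R[i]]_2 * R[i])) :
  (forall k, k \in s -> hermitian_mx k.1) ->
  (forall X, hermitian_mx X -> sums_to (fun H => u H * qpow H X) 0) ->
  forall X, hermitian_mx X ->
    sums_to (fun H => u H * averaging_weight s H * qpow H X) 0.
Proof.
move=> hs hu; elim: s hs => [|[Y c] s IH] hs X hX.
  apply: eq_sums_to (hu X hX) => H; by rewrite /averaging_weight big_nil mulr1.
have {}IH := IH (fun k ks => hs k (mem_behead (s := _ :: _) ks)).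
have hY : hermitian_mx Y by apply: (hs (Y, c)); rewrite mem_head.
have hXY : hermitian_mx (X + Y) by rewrite /hermitian_mx conjtrD hX hY.
have := sums_toD (sums_toZ 2^-1 (IH X hX)) (sums_toZ (2^-1 * c) (IH _ hXY)).
rewrite !mulr0 addr0; apply: eq_sums_to => H.
by rewrite /averaging_weight big_cons /= qpowDr; ring.
Qed.

Lemma le_normc_averaging_weight s (H : 'M[QI]_2) : hermitian_mx H ->
  (forall k, k \in s -> hermitian_mx k.1 /\ normc k.2 = 1) ->
  normc (averaging_weight s H) <= 1.
Proof.
move=> hH hs; rewrite /averaging_weight normc_prod big_seq.
apply: prodr_ile1 => k /hs[hk ck]; rewrite normc_ge0 /= normcM normcV.
rewrite natC2 normc_real ger0_norm // mulrC ler_pdivrMr // mul1r.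
apply: le_trans (ler_normcD _ _) _.
by rewrite normcM ck normc_qpow_herm // mul1r (_ : normc 1 = 1 :> R) //; exact: normc1.
Qed.

(** A finite set of exponents carries the series up to [e], and the product of
    the averages separating its elements from [H0] isolates the coefficient at
    [H0] without enlarging the remainder. *)
Lemma fourier_coefficients_eq0 (u : 'M[QI]_2 -> R[i]) :
  (forall H, ~ hermitian_mx H -> u H = 0) ->
  (forall X, hermitian_mx X -> sums_to (fun H => u H * qpow H X) 0) ->
  forall H, u H = 0.
Proof.
move=> unh hu H0; case: (pselect (hermitian_mx H0)) => hH0; last exact: unh.
apply: normc_small_eq0 => e e0.
have hX0 : hermitian_mx (0 : 'M[R[i]]_2).
  by rewrite /hermitian_mx /conjtr trmx0 map_mx0.
have hu0 : sums_to u 0.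
  apply: eq_sums_to (hu 0 hX0) => H.
  by rewrite /qpow mulmx0 mxtrace0 mulr0 cexp0 mulr1.
have nu0 H : 0 <= normc (u H) by exact: normc_ge0.
have [A0 hA0] := bounded_sums_tails nu0 (sums_to_bounded_sums hu0) e0.
have sep H : exists Y : 'M[R[i]]_2, hermitian_mx Y /\
    (hermitian_mx H -> H != H0 -> qpow H Y = - qpow H0 Y).
  case: (pselect (hermitian_mx H /\ H != H0)) => [[hH HH0]|h].
    have [Y hY qY] := separating_direction R hH hH0 HH0.
    by exists Y; split.
  by exists 0; split=> // hH HH0; case: h.
pose Y H := projT1 (cid (sep H)).
have hY H : hermitian_mx (Y H) by rewrite /Y; case: cid => ? [].
have qY H : hermitian_mx H -> H != H0 -> qpow H (Y H) = - qpow H0 (Y H).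
  by rewrite /Y; case: cid => ? [].
pose s := [seq (Y H, (qpow H0 (Y H))^-1) | H <- A0].
have hs k : k \in s -> hermitian_mx k.1 /\ normc k.2 = 1.
  case/mapP => H _ ->; split; first exact: hY.
  by rewrite normcV normc_qpow_herm ?invr1.
have w0 : averaging_weight s H0 = 1.
  rewrite /averaging_weight big_map big1 // => H _ /=.
  by rewrite mulVf ?qpow_neq0 // mulVf ?pnatr_eq0.
have wA H : H \in A0 -> hermitian_mx H -> H != H0 -> averaging_weight s H = 0.
  move=> HA hH HH0.
  rewrite /averaging_weight big_map (big_fsetD1 H HA) /= qY // mulrN.
  by rewrite mulVf ?qpow_neq0 // subrr mulr0 mul0r.
have huw : sums_to (fun H => u H * averaging_weight s H) 0.
  apply: eq_sums_to (sums_to_averaging (fun k ks => (hs k ks).1) hu hX0) => H.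
  by rewrite /qpow mulmx0 mxtrace0 mulr0 cexp0 mulr1.
have := sums_to_small (A0 := H0 |` A0) (e := e) huw _.
rewrite (big_fsetD1 H0) ?fset1U1 //= w0 mulr1 big1_seq; last first.
  move=> H /andP[_]; rewrite !inE => /andP[HH0]; rewrite (negbTE HH0) /= => HA.
  case: (pselect (hermitian_mx H)) => hH; last by rewrite unh // mul0r.
  by rewrite wA // mulr0.
rewrite addr0 sub0r normc_opp; apply => B dB.
apply: le_trans (hA0 B _); last first.
  by apply: fdisjointWl dB; apply: fsubsetUr.
apply: ler_sum => H _; case: (pselect (hermitian_mx H)) => hH; last first.
  by rewrite unh // mul0r.
rewrite normcM -[leRHS]mulr1; apply: ler_wpM2l => //.
exact: le_normc_averaging_weight.
Qed.

Lemma qseries_unique (F : 'M[R[i]]_2 -> R[i]) (a c : qseries R) :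
  fourier_expansion F a -> fourier_expansion F c ->
  forall H, Lambda2_ge0 R H -> a H = c H.
Proof.
move=> ha hc H0 hH0.
pose u H : R[i] :=
  if H \in Lambda2_ge0 R then (a H - c H) * qpow H 'i%C%:M else 0.
have u0 : u H0 = 0.
  apply: fourier_coefficients_eq0 => [H hH|X hX].
    rewrite /u; case: ifPn => //; rewrite inE => -[[hH' _ _] _].
    by case: hH.
  have hZ := upper_half_addi hX.
  have /sums_toP h1 := ha _ hZ; have /sums_toP h2 := hc _ hZ.
  have := sums_toD h1 (sums_toZ (-1) h2).
  rewrite mulN1r subrr; apply: eq_sums_to => H; rewrite /qterm /u.
  by case: ifP => _; rewrite ?qpowDr; ring.
move: u0; rewrite /u ifT ?inE // => /eqP.
by rewrite mulf_eq0 (negbTE (qpow_neq0 _ _)) orbF subr_eq0 => /eqP.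
Qed.
End Uniqueness.

(** * Fourier coefficients as signed counts of tuples *)

Section Coefficients.
Variable I : finType.
Notation G := 'cV[gauss_int]_2.
Implicit Types (a b : G) (x : {ffun I -> G}) (H : 'M[QI]_2).

Definition theta_fibre a H : {fset {ffun I -> G}} :=
  fset_set [set x | gram_sum a x = H]%classic.

Definition theta_coef a b H : int := \sum_(x <- theta_fibre a H) sign_prod b x.

Section OverR.
Variable R : realType.

Lemma normc_prod_theta_term a b (Z : 'M[R[i]]_2) x :
  \prod_i normc (theta_term a b Z (x i)) = normc (qpow (gram_sum a x) Z).
Proof.
rewrite -normc_prod prod_theta_term normcM.
suff -> : normc ((sign_prod b x)%:~R : R[i]) = 1 by rewrite mul1r.
rewrite /sign_prod rmorph_prod normc_prod big1 // => i _.
exact: normc_theta_sign.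
Qed.

(** All terms of a fibre have the same absolute value, so a fibre of an
    absolutely convergent series is finite. *)
Lemma mem_theta_fibre a x H : (x \in theta_fibre a H) = (gram_sum a x == H).
Proof.
pose Z : 'M[R[i]]_2 := 0 + 'i%C%:M.
have hZ : upper_half Z.
  by apply: upper_half_addi; rewrite /hermitian_mx /conjtr trmx0 map_mx0.
rewrite /theta_fibre in_fset_set; first by apply/idP/eqP; rewrite inE.
have hb := bounded_sums_ffun I (fun g => normc_ge0 (theta_term a 0 Z g))
  (bounded_sums_theta_term a 0 hZ).
apply: (finite_level_set hb (c := normc (qpow H Z))) => [|y /= <-].
  by rewrite normc_qpow expR_gt0.
by rewrite normc_prod_theta_term.
Qed.

Lemma sums_to_theta_power a b (Z : 'M[R[i]]_2) : upper_half Z ->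
  sums_to (fun H => (theta_coef a b H)%:~R * qpow H Z)
    (theta_const (a, b) Z ^+ #|I|).
Proof.
move=> hZ; have h := sums_to_ffun I (sums_to_theta_const a b hZ).
have hf x H : (x \in theta_fibre a H) = (gram_sum a x == H).
  exact: mem_theta_fibre.
apply: eq_sums_to (sums_to_fibres hf h) => H.
rewrite /theta_coef rmorph_sum mulr_suml; apply: eq_fbigr => x.
by rewrite hf prod_theta_term => /eqP ->.
Qed.

(** This is the coefficient of [psi_4k] when [I] has [4 k] elements. *)
Definition psi_coef H : R[i] :=
  4^-1 * (\sum_(m <- even_characteristics) theta_coef m.1 m.2 H)%:~R.

Lemma sums_to_psi4 k (Z : 'M[R[i]]_2) : #|I| = (4 * k)%N -> upper_half Z ->
  sums_to (fun H => psi_coef H * qpow H Z) (psi4 k Z).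
Proof.
move=> cI hZ.
have h (m : G * G) := sums_to_theta_power m.1 m.2 hZ.
have := sums_toZ 4^-1 (sums_to_big even_characteristics h).
rewrite cI /psi4; under eq_bigr do rewrite -surjective_pairing.
by apply: eq_sums_to => H; rewrite -mulr_suml -rmorph_sum mulrA.
Qed.
End OverR.

End Coefficients.

(** * Exponents in the lattice *)

Section Support.
Variable I : finType.
Notation G := 'cV[gauss_int]_2.
Implicit Types (a b : G) (x : {ffun I -> G}) (H : 'M[QI]_2).

Lemma half_gramE (v : 'cV[QI]_2) j l : half_gram v j l =
  (2^-1 * (complex.Re (v j 0) * complex.Re (v l 0)
           + complex.Im (v j 0) * complex.Im (v l 0))) +i*
  (2^-1 * (complex.Im (v j 0) * complex.Re (v l 0)
           - complex.Re (v j 0) * complex.Im (v l 0))).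
Proof.
rewrite !mxE big_ord1 !mxE; case: (v j 0) (v l 0) => [P Q] [S T] /=.
have -> : (2^-1 : QI) = 2^-1 +i* 0.
  by apply: (mulfI (x := 2)); rewrite ?pnatr_eq0 // divff ?pnatr_eq0 //.
by simpc; congr (_ +i* _); ring.
Qed.

Lemma sum_complex (K : Type) (r : seq K) (f g : K -> rat) :
  \sum_(i <- r) (f i +i* g i) = (\sum_(i <- r) f i) +i* (\sum_(i <- r) g i).
Proof.
elim: r => [|i r IH]; first by rewrite !big_nil.
by rewrite !big_cons IH.
Qed.

Lemma shiftedE a (g : G) j : shifted a g j 0 =
  ((complex.Re (g j 0))%:~R
    + 2^-1 * ((complex.Re (a j 0))%:~R - (complex.Im (a j 0))%:~R)) +i*
  ((complex.Im (g j 0))%:~R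
    + 2^-1 * ((complex.Re (a j 0))%:~R + (complex.Im (a j 0))%:~R)).
Proof.
rewrite !mxE /gaussQ /omegaQ; simpc.
by congr (_ +i* _); ring.
Qed.

Definition coord_sum x j : int :=
  \sum_i (complex.Re (x i j 0) + complex.Im (x i j 0)).

Lemma gram_sum_hermitian a x : hermitian_mx (gram_sum a x).
Proof.
apply/matrixP => j l; rewrite !mxE !summxE.
under eq_bigr do rewrite half_gramE.
under [in RHS]eq_bigr do rewrite half_gramE.
rewrite !sum_complex /= -sumrN; congr (_ +i* _); apply: eq_bigr => i _; ring.
Qed.

Lemma possemidef_gram_sum (R : realType) a x :
  possemidef_mx (map_mx (@QI_to_C R) (gram_sum a x)).
Proof.
split; first exact/hermitian_map_QI/gram_sum_hermitian.
move=> v; rewrite /gram_sum map_mx_sum /herm_act mulmx_sumr mulmx_suml summxE.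
apply: sumr_ge0 => i _; rewrite /half_gram map_mxZ map_mxM map_QI_to_C_conjtr.
set w := map_mx _ _; rewrite -scalemxAr -scalemxAl.
have -> : conjtr v *m (w *m conjtr w) *m v =
    conjtr (conjtr w *m v) *m (conjtr w *m v).
  by rewrite conjtrM conjtrK !mulmxA.
rewrite mxE fmorphV rmorph_nat mulr_ge0 ?invr_ge0 ?ler0n //.
by rewrite mxE big_ord1 !mxE mulrC mulcJ_ge0.
Qed.

(** With [s = coord_sum x], and up to integers, the real and imaginary parts of
    [2 H_jl] are [1/2 (a_l s_j + a_j s_l)] and the diagonal entries of [H] are
    [1/2 (1 + a_j) s_j], as [x ^ 2 = x] modulo [2]. The size [4 k] of the
    tuples makes the contribution of [omega a] to the Gram matrix integral. *)
Lemma Lambda2_gram_sum a x k (al : 'I_2 -> int) : #|I| = (4 * k)%N ->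
  (forall j, a j 0 = al j +i* 0) ->
  (forall j, (2 %| (1 + al j) * coord_sum x j)%Z) ->
  (forall j l, (2 %| al l * coord_sum x j + al j * coord_sum x l)%Z) ->
  Lambda2 (gram_sum a x).
Proof.
move=> cI ha hdiag hoff.
pose X j i : int := complex.Re (x i j 0); pose Y j i : int := complex.Im (x i j 0).
pose s := coord_sum x.
pose E j l : int := \sum_i (X j i * X l i + Y j i * Y l i).
pose F j l : int := \sum_i (Y j i * X l i - X j i * Y l i).
pose D j : int := \sum_i X j i.
have sE j : s j = \sum_i (X j i + Y j i) by [].
have gE j l : gram_sum a x j l =
   (2^-1 * ((E j l)%:~R + 2^-1 * (al l * s j + al j * s l)%:~R
      + 2 * (k%:Z * (al j * al l))%:~R)) +i*
   (2^-1 * ((F j l)%:~R + 2^-1 * (al l * (s j - 2 * D j)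
                                  - al j * (s l - 2 * D l))%:~R)).
  rewrite summxE; under eq_bigr do rewrite half_gramE !shiftedE !ha /=.
  rewrite sum_complex -!mulr_sumr; congr ((_ * _) +i* (_ * _)).
    transitivity (\sum_i ((X j i * X l i + Y j i * Y l i)%:~R + 2^-1 *
       (al l * (X j i + Y j i) + al j * (X l i + Y l i))%:~R
       + 2^-1 * (al j * al l)%:~R) : rat).
      by apply: eq_bigr => i _; rewrite !(intrD, intrM) /X /Y; field.
    have sT : \sum_i (al l * (X j i + Y j i) + al j * (X l i + Y l i)) =
        al l * s j + al j * s l by rewrite big_split /= -!mulr_sumr.
    rewrite !big_split /= -mulr_sumr -!rmorph_sum /= sT sumr_const cI.
    rewrite -[_ *+ (4 * k)%N]mulr_natl natrM; congr (_ + _).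
    by rewrite !intrM; field.
  transitivity (\sum_i ((Y j i * X l i - X j i * Y l i)%:~R + 2^-1 *
     (al l * (X j i + Y j i - 2 * X j i)
      - al j * (X l i + Y l i - 2 * X l i))%:~R) : rat).
    by apply: eq_bigr => i _; rewrite !(intrD, intrM, rmorphN) /X /Y; field.
  have sT : \sum_i (al l * (X j i + Y j i - 2 * X j i)
      - al j * (X l i + Y l i - 2 * X l i)) =
      al l * (s j - 2 * D j) - al j * (s l - 2 * D l).
    by rewrite sumrB -!mulr_sumr !sumrB -!mulr_sumr.
  by rewrite big_split /= -mulr_sumr -!rmorph_sum /= sT.
have hD j l : (2 %| al l * (s j - 2 * D j) - al j * (s l - 2 * D l))%Z.
  have := hoff j l; rewrite -/s; lia.
have hE j : (2 %| E j j - s j)%Z.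
  rewrite sE -sumrB; apply: rpred_sum => i _.
  have h (n : int) : (2 %| n * n - n)%Z.
    have := modz_ge0 n (isT : 2 != 0 :> int).
    have := ltz_pmod n (isT : 0 < 2 :> int).
    by have := divz_eq n 2; nia.
  by rewrite opprD addrACA rpredD.
split; first exact: gram_sum_hermitian.
- move=> j; rewrite gE.
  have [u hu] := dvdzP (hE j); have [w hw] := dvdzP (hdiag j).
  exists (u + w + k%:Z * (al j * al j)).
  have -> : E j j = s j + u * 2 by lia.
  have FE : F j j = 0 by apply: big1 => i _; ring.
  rewrite FE subrr mulr0z !mulr0; congr (_ +i* _).
  have := congr1 (fun n : int => n%:~R : rat) hw.
  by rewrite -/(s j) !(intrD, intrM) => hw'; lra.
move=> j l; rewrite gE.
have [u hu] := dvdzP (hoff j l); have [w hw] := dvdzP (hD j l).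
exists (E j l + u + 2 * (k%:Z * (al j * al l))), (F j l + w).
rewrite -/s in hu; rewrite hu hw.
have -> : (2 : QI) = 2 +i* 0 by apply/eqP; rewrite eq_complex.
by simpc; congr (_ +i* _); rewrite !(intrD, intrM); field.
Qed.
End Support.

Section EvenCharacteristics.
Variable I : finType.
Notation G := 'cV[gauss_int]_2.
Implicit Types (a : G) (x : {ffun I -> G}) (H : 'M[QI]_2).

Definition parity_sign (n : int) : int := (-1) ^+ `|n|%N.

Lemma parity_signE n : parity_sign n = if (2 %| n)%Z then 1 else -1.
Proof.
rewrite /parity_sign -signr_odd (_ : odd `|n| = ~~ (2 %| n)%Z); last by lia.
by case: (2 %| n)%Z.
Qed.

Lemma parity_signD m n : parity_sign (m + n) = parity_sign m * parity_sign n.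
Proof.
rewrite !parity_signE.
by case: ifP; case: ifP; case: ifP => //; lia.
Qed.

Lemma sign_prodE (b : G) x (be : 'I_2 -> int) : (forall j, b j 0 = be j +i* 0) ->
  sign_prod b x = parity_sign (be 0 * coord_sum x 0 + be 1 * coord_sum x 1).
Proof.
move=> hb; rewrite /sign_prod.
have -> : \prod_i theta_sign b (x i) =
    parity_sign (\sum_i theta_exponent b (x i)).
  by elim/big_rec2: _ => [//|i u v _ ->]; rewrite parity_signD.
have -> : \sum_i theta_exponent b (x i) =
    \sum_i (be 0 * (complex.Re (x i 0 0) - complex.Im (x i 0 0))
            + be 1 * (complex.Re (x i 1 0) - complex.Im (x i 1 0))).
  apply: eq_bigr => i _; rewrite /theta_exponent !big_ord_recl big_ord0 !hb /=.
  rewrite (_ : lift ord0 ord0 = 1 :> 'I_2); last exact: val_inj.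
  by ring.
have e j : \sum_i (complex.Re (x i j 0) - complex.Im (x i j 0)) =
    coord_sum x j - 2 * \sum_i complex.Im (x i j 0).
  by rewrite /coord_sum mulr_sumr -sumrB; apply: eq_bigr => i _; ring.
rewrite big_split /= -!mulr_sumr !e !parity_signE; congr (if _ then _ else _).
by set s := coord_sum x 0; set t := coord_sum x 1; lia.
Qed.

(** Summing over the second half [b] of the characteristic projects onto the
    tuples satisfying parity conditions, which are those that put the Gram
    matrix in the lattice. *)
Lemma sum_theta_coef_support (R : realType) k (a1 a2 : int)
    (bs : seq (int * int)) H : #|I| = (4 * k)%N ->
  (forall s t : int,
     \sum_(b <- bs) parity_sign (b.1 * s + b.2 * t) != 0 ->
     [/\ 2 %| (1 + a1) * s, 2 %| (1 + a2) * t & 2 %| a2 * s + a1 * t]%Z) ->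
  ~ Lambda2_ge0 R H ->
  \sum_(b <- bs) theta_coef I (characteristic a1 a2 b.1 b.2).1
                              (characteristic a1 a2 b.1 b.2).2 H = 0.
Proof.
move=> cI hbs nH; pose c (b : int * int) := characteristic a1 a2 b.1 b.2.
pose a : G := (c (0, 0)).1.
transitivity (\sum_(x <- theta_fibre I a H) \sum_(b <- bs) sign_prod (c b).2 x).
  by rewrite exchange_big.
rewrite big_seq big1 // => x; rewrite (mem_theta_fibre R) => /eqP xH.
apply/eqP; apply: contra_notT nH => h.
have hs (b : int * int) : sign_prod (c b).2 x =
    parity_sign (b.1 * coord_sum x 0 + b.2 * coord_sum x 1).
  by rewrite (sign_prodE x (be := tnth [tuple b.1; b.2])) // => j; rewrite mxE.
move: h; under eq_bigr do rewrite hs.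
move=> /hbs[h1 h2 h3]; rewrite -xH; split; last exact: possemidef_gram_sum.
have h2I (P : 'I_2 -> Prop) : P 0 -> P 1 -> forall j, P j.
  move=> P0 P1 [[|[|//]] hj].
    by rewrite (_ : Ordinal hj = 0) //; apply: val_inj.
  by rewrite (_ : Ordinal hj = 1) //; apply: val_inj.
apply: (Lambda2_gram_sum (al := tnth [tuple a1; a2]) cI).
- by move=> j; rewrite mxE.
- exact: h2I.
by apply: (h2I); apply: (h2I); rewrite /tnth /=;
  set s := coord_sum x 0 in h1 h2 h3 *; set t := coord_sum x 1 in h1 h2 h3 *; lia.
Qed.

Lemma psi_coef_support (R : realType) k H : #|I| = (4 * k)%N ->
  ~ Lambda2_ge0 R H -> psi_coef I R H = 0.
Proof.
move=> cI nH; rewrite /psi_coef.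
suff -> : \sum_(m <- even_characteristics) theta_coef I m.1 m.2 H = 0.
  by rewrite mulr0.
have -> : even_characteristics =
    [seq characteristic 0 0 b.1 b.2 | b <- [:: (0, 0); (0, 1); (1, 0); (1, 1)]] ++
    [seq characteristic 0 1 b.1 b.2 | b <- [:: (0, 0); (1, 0)]] ++
    [seq characteristic 1 0 b.1 b.2 | b <- [:: (0, 0); (0, 1)]] ++
    [seq characteristic 1 1 b.1 b.2 | b <- [:: (0, 0); (1, 1)]] by [].
rewrite !big_cat !big_map /=.
rewrite !(sum_theta_coef_support cI _ nH) => [|s t|s t|s t|s t] //=.
all: rewrite !big_cons big_nil /= !parity_signE.
all: do ?[case: ifP => ?] => ?; split; lia.
Qed.
End EvenCharacteristics.

(** * The cyclic shift of a tuple *)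

(** The periods [p] and [d] are coprime, hence [1] is a period. *)
Lemma iter_period_prime (T : Type) (f : T -> T) (x : T) p d :
  prime p -> iter p f x = x -> iter d f x = x -> (0 < d < p)%N -> f x = x.
Proof.
move=> pp fp fd /andP[d0 dp].
have fm m u : iter m f x = x -> iter (u * m) f x = x.
  by move=> h; elim: u => // u IH; rewrite mulSn iterD IH.
have /(coprimeP _ d0)[[u v] /= uv] : coprime d p.
  by rewrite coprime_sym prime_coprime // gtnNdvd.
have e : (u * d = (v * p).+1)%N by lia.
by have := fm d u fd; rewrite e iterS fm.
Qed.

(** Each orbit is the image of [k |-> f^k x] on [0 <= k < p], injective because
    a coincidence would make [x] fixed; it contributes [p F(x)]. *)
Lemma dvdz_sum_free_orbits (T : choiceType) (p : nat) (f : T -> T) (F : T -> int)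
    (A : {fset T}) :
  prime p -> (forall x, iter p f x = x) -> (forall x, F (f x) = F x) ->
  (forall x, x \in A -> f x \in A) -> (forall x, x \in A -> f x <> x) ->
  (p %| \sum_(x <- A) F x)%Z.
Proof.
move=> pp fp Ff; have p0 := prime_gt0 pp.
have [n] := ubnP #|` A|; elim: n A => // n IH A cA fA fixA.
have [->|[x xA]] := fset_0Vmem A; first by rewrite big_seq_fset0 dvdz0.
have itA k : iter k f x \in A by elim: k => // k /fA.
pose O := [fset iter (k : 'I_p) f x | k in {: 'I_p}].
have inO k : iter k f x \in O.
  apply/imfsetP; exists (Ordinal (ltn_pmod k p0)) => //=.
  rewrite {1}(divn_eq k p) addnC iterD; congr (iter _ f _).
  by elim: (k %/ p)%N => // u IHu; rewrite mulSn iterD IHu fp.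
have sOA : O `<=` A by apply/fsubsetP => _ /imfsetP[k _ ->].
have F_iter k y : F (iter k f y) = F y by elim: k => // k /= <-; rewrite Ff.
have injO : {in {: 'I_p} &, injective (fun k : 'I_p => iter k f x)}.
  move=> k l _ _ /= kl; apply/val_inj => /=.
  wlog kl_lt : k l kl / (k < l)%N.
    by move=> h; case: (ltngtP k l) => // kl'; [|symmetry]; apply: h.
  case: (fixA x xA); apply: (iter_period_prime pp (fp x) (d := l - k)).
    rewrite -[RHS]fp -[in RHS](subnK (ltnW (ltn_ord k))) iterD kl -iterD.
    rewrite (_ : (p - k + l)%N = (l - k + p)%N) ?iterD ?fp //.
    by have := ltn_ord k; lia.
  by have := ltn_ord l; lia.
rewrite (sum_fsetDK _ sOA); apply: rpredD.
  rewrite /O big_imfset //= big_enum /=.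
  rewrite (eq_bigr (fun _ => F x)) => [|k _]; last exact: F_iter.
  by rewrite sumr_const cardT size_enum_ord -mulr_natl natz dvdz_mulr.
apply: IH.
- apply: leq_trans (_ : #|` A| <= n)%N; last by rewrite -ltnS.
  apply: fproper_ltn_card; rewrite fproperEneq fsubsetDl andbT.
  apply/eqP => /fsetP/(_ x); rewrite inE xA andbT.
  by have := inO 0; rewrite /= => ->.
- move=> y; rewrite !inE => /andP[yO yA]; rewrite fA // andbT.
  apply: contra yO => /imfsetP[k _ /= fy].
  by rewrite -(fp y) -(prednK p0) iterSr fy -iterD inO.
by move=> y; rewrite inE => /andP[_ /fixA].
Qed.

Section CyclicShift.
Variables (p : nat) (pp : prime p).
Notation G := 'cV[gauss_int]_2.
Notation I := ('F_p + unit)%type.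
Implicit Types (a b : G) (x : {ffun I -> G}) (H : 'M[QI]_2).

(** The index set of [p + 1] elements: translation by [1] on the field of [p]
    elements, and one more point. *)
Definition rotate (i : I) : I := if i is inl j then inl (j + 1) else i.

Definition cyclic_shift x : {ffun I -> G} := [ffun i => x (rotate i)].

Lemma rotate_inj : injective rotate.
Proof.
move=> [i|[]] [j|[]] //= /(congr1 (fun s : I => if s is inl y then y else 0)).
by move=> /addIr ->.
Qed.

Lemma iter_rotate n (j : 'F_p) : iter n rotate (inl j) = inl (j + n%:R).
Proof.
elim: n => [|n IH]; first by rewrite addr0.
by rewrite iterS IH /= -addrA natr1.
Qed.

Lemma iter_cyclic_shift x : iter p cyclic_shift x = x.
Proof.
have h n : iter n cyclic_shift x = [ffun i => x (iter n rotate i)].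
  elim: n => [|n IH]; first by apply/ffunP => i; rewrite ffunE.
  by rewrite iterS IH; apply/ffunP => i; rewrite !ffunE -iterSr.
rewrite h; apply/ffunP => -[j|u]; rewrite ffunE.
  by rewrite iter_rotate pchar_Fp_0 // addr0.
by rewrite iter_fix.
Qed.

Lemma gram_sum_cyclic_shift a x : gram_sum a (cyclic_shift x) = gram_sum a x.
Proof.
rewrite /gram_sum [RHS](reindex_inj rotate_inj).
by apply: eq_bigr => i _; rewrite ffunE.
Qed.

Lemma sign_prod_cyclic_shift b x : sign_prod b (cyclic_shift x) = sign_prod b x.
Proof.
rewrite /sign_prod [RHS](reindex_inj rotate_inj).
by apply: eq_bigr => i _; rewrite ffunE.
Qed.

Lemma gram_sum_fixed a x : cyclic_shift x = x -> gram_sum a x =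
  half_gram (shifted a (x (inl 0))) *+ p + half_gram (shifted a (x (inr tt))).
Proof.
move=> sx.
have h n : x (iter n rotate (inl 0)) = x (inl 0).
  by elim: n => // n IH; rewrite iterS -[in RHS]IH -[in RHS]sx ffunE.
rewrite /gram_sum big_sumType /= (big_pred1 tt) => [|[] //]; congr (_ + _).
rewrite (eq_bigr (fun _ => half_gram (shifted a (x (inl 0))))) => [|j _].
  by rewrite sumr_const card_Fp.
by have := h j; rewrite iter_rotate add0r natr_Zp => ->.
Qed.

End CyclicShift.

(** * Determinants of exponents *)

Lemma det22 (S : comPzRingType) (A : 'M[S]_2) :
  \det A = A 0 0 * A 1 1 - A 0 1 * A 1 0.
Proof.
rewrite (expand_det_row _ 0) !big_ord_recl big_ord0 /cofactor !det_mx11 !mxE /=.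
rewrite addr0 expr0 expr1 mul1r mulN1r mulrN.
by congr (_ * A _ _ - A _ _ * A _ _); apply: val_inj.
Qed.

Lemma det22_complex (A : 'M[QI]_2) : \det A =
  (complex.Re (A 0 0) * complex.Re (A 1 1) - complex.Im (A 0 0) * complex.Im (A 1 1)
   - (complex.Re (A 0 1) * complex.Re (A 1 0)
      - complex.Im (A 0 1) * complex.Im (A 1 0))) +i*
  (complex.Re (A 0 0) * complex.Im (A 1 1) + complex.Im (A 0 0) * complex.Re (A 1 1)
   - (complex.Re (A 0 1) * complex.Im (A 1 0)
      + complex.Im (A 0 1) * complex.Re (A 1 0))).
Proof.
rewrite det22.
by case: (A 0 0) (A 0 1) (A 1 0) (A 1 1) => [? ?] [? ?] [? ?] [? ?]; simpc.
Qed.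

(** With [v'] the conjugate transpose,
    [det (p v v' + w w') = p |v_0 w_1 - v_1 w_0|^2]; the shifted vectors have
    coordinates in [1/2 Z], which together with the two factors [1/2] of the
    Gram matrix makes the denominator [64]. *)
Lemma det_half_gram_sum a g h p : exists z : int,
  \det (half_gram (shifted a g) *+ p + half_gram (shifted a h)) =
  (p%:R * z%:~R / 64) +i* 0.
Proof.
have hs (y : 'cV[gauss_int]_2) : exists U V : 'I_2 -> int,
    forall j, shifted a y j 0 = (2^-1 * (U j)%:~R) +i* (2^-1 * (V j)%:~R).
  exists (fun j => 2 * complex.Re (y j 0) + (complex.Re (a j 0) - complex.Im (a j 0))).
  exists (fun j => 2 * complex.Im (y j 0) + (complex.Re (a j 0) + complex.Im (a j 0))).
  move=> j; rewrite shiftedE !(intrD, intrM, rmorphN) /=.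
  by congr (_ +i* _); field.
have [U [V hg]] := hs g; have [u [v hh]] := hs h.
exists ((U 0 * u 1 - V 0 * v 1 - U 1 * u 0 + V 1 * v 0) ^+ 2
        + (U 0 * v 1 + V 0 * u 1 - U 1 * v 0 - V 1 * u 0) ^+ 2).
have hE j l : (half_gram (shifted a g) *+ p + half_gram (shifted a h)) j l =
    (2^-1 * (2^-1 * 2^-1) * (p%:R * ((U j)%:~R * (U l)%:~R + (V j)%:~R * (V l)%:~R)
       + ((u j)%:~R * (u l)%:~R + (v j)%:~R * (v l)%:~R))) +i*
    (2^-1 * (2^-1 * 2^-1) * (p%:R * ((V j)%:~R * (U l)%:~R - (U j)%:~R * (V l)%:~R)
       + ((v j)%:~R * (u l)%:~R - (u j)%:~R * (v l)%:~R))).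
  rewrite [LHS]mxE mulmxnE -[_ *+ p]mulr_natl !half_gramE !hg !hh /=.
  have -> : p%:R = p%:R +i* 0 :> QI by rewrite -(rmorph_nat (real_complex rat)).
  by simpc; congr (_ +i* _); ring.
rewrite det22_complex (hE 0 0) (hE 0 1) (hE 1 0) (hE 1 1) /=.
rewrite !(intrD, rmorphN, intrM, rmorphXn) /=.
congr (_ +i* _); last by ring.
by field.
Qed.

Lemma p_integral_pow2 p n (z : int) : prime p -> odd p ->
  p_integral p (z%:~R / (2 ^ n)%:R).
Proof.
move=> pp op; rewrite /p_integral /=; set r := _ / _; apply/negP => pd.
have e : numq r * (2 ^ n)%:Z = z * denq r.
  apply: (@intr_inj rat); rewrite !intrM.
  have n0 : (2 ^ n)%:R != 0 :> rat by rewrite pnatr_eq0 expn_eq0.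
  have d0 : (denq r)%:~R != 0 :> rat by rewrite intr_eq0 denq_neq0.
  apply: (mulIf (invr_neq0 d0)); rewrite mulfK // mulrAC divq_num_den.
  by rewrite /r -pmulrn divfK.
have : (p %| `|numq r| * 2 ^ n)%N.
  by rewrite -[(2 ^ n)%N]/(`|(2 ^ n)%:Z|%N) -abszM e abszM dvdn_mull.
rewrite Euclid_dvdM // => /orP[pn|]; last first.
  by rewrite Euclid_dvdX // dvdn_prime2 // => /andP[/eqP p2 _]; rewrite p2 in op.
have := coprime_num_den r; rewrite /coprime => /eqP g1.
have : (p %| gcdn `|numq r| `|denq r|)%N by rewrite dvdn_gcd pn pd.
by rewrite g1 dvdn1 => /eqP p1; rewrite p1 in pp.
Qed.

Lemma det_Lambda2 (H : 'M[QI]_2) : Lambda2 H ->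
  exists d : int, \det H = (d%:~R / 4) +i* 0.
Proof.
move=> [hH hd ho]; have [n0 h00] := hd 0; have [n1 h11] := hd 1.
have [u [v h01]] := ho 0 1.
have h10 : H 1 0 = conjc (H 0 1).
  by have := congr1 (fun M : 'M_2 => M 1 0) hH; rewrite !mxE.
exists (4 * (n0 * n1) - (u * u + v * v)).
rewrite det22_complex h10 h00 h11.
have {h01} : H 0 1 = (u%:~R / 2) +i* (v%:~R / 2).
  apply: (mulfI (x := 2)); first by rewrite eq_complex.
  rewrite h01; have -> : (2 : QI) = 2 +i* 0 by apply/eqP; rewrite eq_complex.
  by simpc; congr (_ +i* _); field.
move=> -> /=; rewrite !(intrD, rmorphN, intrM) /=.
by congr (_ +i* _); field.
Qed.

(** * The congruence *)

Section Congruence.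
Variable R : realType.
Variables (p k : nat).
Hypotheses (pp : prime p) (pk : p.+1 = (4 * k)%N).
Notation I := ('F_p + unit)%type.

Lemma card_shift_index : #|{: I}| = (4 * k)%N.
Proof. by rewrite card_sum card_Fp // card_unit addn1. Qed.

(** Either the cyclic shift fixes some tuple with Gram matrix [H], which then
    has the form of [gram_sum_fixed], or it acts freely on all these tuples. *)
Lemma det_or_coef_dvd (H : 'M[QI]_2) :
  (exists z : int, \det H = (p%:R * z%:~R / 64) +i* 0) \/
  (forall a b, (p %| theta_coef I a b H)%Z).
Proof.
case: (pselect (exists a (x : {ffun I -> _}), gram_sum a x = H /\ cyclic_shift x = x)).
  move=> [a [x [<- /(gram_sum_fixed pp a) ->]]]; left.
  exact: det_half_gram_sum.
move=> nfix; right=> a b; apply: (dvdz_sum_free_orbits (f := @cyclic_shift p)) => //.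
- exact: iter_cyclic_shift.
- exact: sign_prod_cyclic_shift.
- by move=> x; rewrite !(mem_theta_fibre R) gram_sum_cyclic_shift.
move=> x; rewrite (mem_theta_fibre R) => /eqP xH sx.
by apply: nfix; exists a, x.
Qed.

Lemma fourier_expansion_psi4 :
  fourier_expansion (@psi4 R k) (psi_coef I R).
Proof.
move=> Z hZ; apply/sums_toP.
apply: eq_sums_to (sums_to_psi4 card_shift_index hZ) => H.
rewrite /qterm; case: ifPn => //; rewrite notin_setE => nH.
by rewrite (psi_coef_support card_shift_index nH) mul0r.
Qed.

Lemma congruent_mod_psi_coef :
  congruent_mod p (theta_op (psi_coef I R)) (fun=> 0).
Proof.
move=> H [LH _].
have op : odd p by have := congr1 odd pk; rewrite oddM /=; case: odd.
pose n := \sum_(m <- even_characteristics) theta_coef I m.1 m.2 H.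
have [d detH] := det_Lambda2 LH.
(* [2 ^ 8 = 4 * 64] is a common denominator for the two cases. *)
have [t ht] : exists t : int,
    n%:~R / 4 * (d%:~R / 4) = p%:R * (t%:~R / (2 ^ 8)%:R) :> rat.
  case: (det_or_coef_dvd H) => [[z]|pc].
    rewrite detH => -[dz]; exists (n * z); rewrite dz intrM.
    by rewrite (natrX _ 2 8); field.
  have /dvdzP[q nq] : (p %| n)%Z by apply: rpred_sum => m _; apply: pc.
  exists (q * d * 16); rewrite nq !intrM -pmulrn.
  by rewrite (natrX _ 2 8); field.
exists (n%:~R / 4 * (d%:~R / 4)), 0, (t%:~R / (2 ^ 8)%:R); split.
- have := p_integral_pow2 4 (n * d) pp op.
  by congr p_integral; rewrite intrM (natrX _ 2 4); field.
- by rewrite /p_integral /= dvdn1; case: p pp => [|[|]].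
- exact: p_integral_pow2.
- split; last by rewrite rmorph0.
  rewrite /theta_op /psi_coef -/n detH /QI_to_C /= rmorph0 complexr0.
  have ratrM (u v : rat) : ratr (u * v) = ratr u * ratr v :> R by rewrite rmorphM.
  have e4 : ratr (n%:~R / 4) = n%:~R / 4 :> R by rewrite fmorph_div /= ratr_int ratr_nat.
  rewrite [ratr (_ * (d%:~R / 4))]ratrM e4; move: (ratr (d%:~R / 4)) => y.
  by rewrite rmorphM fmorph_div /= rmorph_int rmorph_nat [4^-1 * _]mulrC.
by rewrite subr0.
Qed.

(** By uniqueness any expansion agrees with [psi_coef] on the lattice. *)
Lemma theta_psi4_congruence :
  (exists a : qseries R, fourier_expansion (@psi4 R k) a) /\
  (forall a : qseries R, fourier_expansion (@psi4 R k) a ->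
     congruent_mod p (theta_op a) (fun=> 0)).
Proof.
split=> [|a ha H hH]; first by exists (psi_coef I R); apply: fourier_expansion_psi4.
have [r [s [t [? ? ? [er es] ?]]]] := congruent_mod_psi_coef hH.
exists r, s, t; split=> //; split=> //; rewrite -er /theta_op.
by rewrite (qseries_unique ha fourier_expansion_psi4).
Qed.

End Congruence.

Theorem theorem4p6 (R : realType) :
  ((exists a : qseries R, fourier_expansion (@psi4 R 2) a) /\
   (forall a : qseries R, fourier_expansion (@psi4 R 2) a ->
      congruent_mod 7 (theta_op a) (fun=> 0%R))) /\
  ((exists a : qseries R, fourier_expansion (@psi4 R 3) a) /\
   (forall a : qseries R, fourier_expansion (@psi4 R 3) a ->
      congruent_mod 11 (theta_op a) (fun=> 0%R))).
Proof. by split; apply: theta_psi4_congruence. Qed.
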